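(* Let $\alpha>0$ and $0\le\beta<1$ be such that $\alpha+\beta>1$, let $X$ be a complex Banach space and let $T\in B(X)$ be an $(\alpha,\beta)$-RK operator. For any $k\in\mathbb{N}\cup\{0\}$ with $k>\alpha-1$, $$\|T^n(I-T)^k\| = O\Big(n^{\frac{\alpha+(\beta-1)(k+1)}{\alpha}}\Big).$$
   Context: $\mathbb{N}=\{1,2,\dots\}$; $B(X)$ is the algebra of bounded linear operators on $X$; $\mathbb{D}$ is the open unit disk; $R(\lambda,T)=(\lambda I-T)^{-1}$. $T\in B(X)$ is an $(\alpha,\beta)$-RK operator if $\sigma(T)\subset\overline{\mathbb{D}}$ and there is $C>0$ with $\|R(\lambda,T)\|\le\frac{C}{|\lambda-1|^{\alpha}(|\lambda|-1)^{\beta}}$ for all $1<|\lambda|<2$ (the limiting case $\beta=0$ is allowed). For nonnegative sequences, $a_n=O(b_n)$ means there is $C>0$ with $a_n\le C b_n$ for all $n\ge1$. *)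

(* Defs.v *)
(* A complex Banach space is a
   [CompleteNormedModule C_AbsRing]; a bounded operator is a map [X -> X]
   satisfying Coquelicot's [is_linear], which includes boundedness. *)
From Stdlib Require Import Reals ClassicalEpsilon.
From Coquelicot Require Import Coquelicot.
Open Scope R_scope.

(* [real] sends an infinite supremum to 0, so this is the operator norm only
   for bounded [A]. *)
Definition opnorm {X : NormedModule C_AbsRing} (A : X -> X) : R :=
  real (Lub_Rbar (fun r => exists x : X, norm x <= 1 /\ r = norm (A x))).

Definition op_sub {X : NormedModule C_AbsRing} (A B : X -> X) : X -> X :=
  fun x => minus (A x) (B x).

Definition op_comp {X : NormedModule C_AbsRing} (A B : X -> X) : X -> X :=
  fun x => A (B x).

Definition op_id {X : NormedModule C_AbsRing} : X -> X := fun x => x.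

Definition op_scalar {X : NormedModule C_AbsRing} (lam : Complex.C) : X -> X :=
  fun x => scal (lam : C_AbsRing) x.

Definition op_pow {X : NormedModule C_AbsRing} (A : X -> X) (n : nat) : X -> X :=
  Nat.iter n (op_comp A) op_id.

Definition is_op_inverse {X : NormedModule C_AbsRing} (A S : X -> X) : Prop :=
  is_linear S /\
  (forall x, op_comp A S x = x) /\ (forall x, op_comp S A x = x).

Definition spectrum {X : NormedModule C_AbsRing} (T : X -> X) (lam : Complex.C) : Prop :=
  ~ exists S : X -> X, is_op_inverse (op_sub (op_scalar lam) T) S.

(* Arbitrary when [lam] is in the spectrum of [T]. *)
Definition resolvent {X : NormedModule C_AbsRing} (lam : Complex.C) (T : X -> X) : X -> X :=
  epsilon (inhabits (fun _ : X => zero))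
    (is_op_inverse (op_sub (op_scalar lam) T)).

(* The bases of both real powers are positive when [1 < Cmod lam]. *)
Definition is_RK {X : NormedModule C_AbsRing} (alpha beta : R) (T : X -> X) : Prop :=
  (forall lam : Complex.C, spectrum T lam -> Cmod lam <= 1) /\
  exists M : R, 0 < M /\
    forall lam : Complex.C, 1 < Cmod lam < 2 ->
      opnorm (resolvent lam T) <=
        M / (Rpower (Cmod (lam - 1)%C) alpha * Rpower (Cmod lam - 1) beta).

Definition is_bigO (a b : nat -> R) : Prop :=
  exists M : R, 0 < M /\ forall n : nat, (1 <= n)%nat -> a n <= M * b n.

(* Main.v *)
(* Put s = alpha / (1 - beta) > 1, x = n^(-1/s), and let lam_j run over the N-th roots of unity times
   r = 1 + 1/(2n).  The discrete Cauchy formula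
     (1/N) sum_j lam_j^(n+1) (1 - lam_j)^k R(lam_j) = T^n (I - T)^k (I - r^-N T^N)^-1
   is an algebraic identity, and r^-N T^N tends to 0 because the spectral radius is at most 1; so it is
   enough to bound the left side by O(x^(k+1-s)), uniformly in large N.  For |lam_j - 1| of order at most x
   the hypothesis gives |R| <= M |lam_j - 1|^-alpha (2n)^beta, which suffices term by term as
   k - alpha > -1.  Further out, moving outwards along the ray until |lam| - 1 is comparable to |lam - 1|^s
   gives |R| <= C |lam_j - 1|^-s, and every difference in j of R costs a factor |lam_j - 1|^-s / N;
   summing by parts k times against lam_j^(n+1) therefore gains (|lam_j - 1|^-s / n)^k, which makes
   the sum over |lam_j - 1| >= x converge at the scale x.  Everything takes place in the bicommutant of T, a
   commutative algebra containing the resolvents. *)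
Require Import Defs.
From Stdlib Require Import Reals Lra Lia Classical ClassicalEpsilon ProofIrrelevance FunctionalExtensionality.
From Coquelicot Require Import Coquelicot.
Open Scope R_scope.

(** * Commutative normed algebras, roots of unity and a discrete Cauchy formula *)

(** Averages over roots of unity stand in for the contour integral of lambda^n (1 - lambda)^k
    R(lambda), so every operator identity is finite and falls to [ring]. The price is uniformity in
    N: a difference in j costs 1/N, while the phase factor z = exp(2 pi i (n+1)/N) has 1/|z - 1| of
    order at most N/n, so N cancels at each summation by parts. The bound on the spectral radius
    comes from the same averages, by Rickart's argument. The radius keeps r^(n+1) <= 3 while
    |lambda| - 1 = 1/(2n). The scale x solves x^-s = n: beyond it a summation by parts begins to
    gain. Inside it, the termwise bound n^beta x^(k+1-alpha) equals x^(k+1-s) because s (1 - beta) =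
    alpha. Outside it, k summations leave the power k - s (k+1) of |lambda - 1|, which is below -1
    for every k since s > 1, so the sum is governed by its inner end and is again of order
    x^(k+1-s). The boundary terms are of order x^k, which is no larger. *)

Record comm_normed_alg := Calg {
  car :> Type;
  azero : car;
  aone : car;
  aadd : car -> car -> car;
  amul : car -> car -> car;
  asub : car -> car -> car;
  aopp : car -> car;
  emb : Complex.C -> car;
  nrm : car -> R;
  calg_ring : ring_theory azero aone aadd amul asub aopp eq;
  emb_1 : emb 1%C = aone;
  emb_add : forall y z, emb (y + z)%C = aadd (emb y) (emb z);
  emb_mul : forall y z, emb (y * z)%C = amul (emb y) (emb z);
  nrm_ge0 : forall a, 0 <= nrm a;
  nrm_1 : nrm aone <= 1;
  nrm_add : forall a b, nrm (aadd a b) <= nrm a + nrm b;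
  nrm_mul : forall a b, nrm (amul a b) <= nrm a * nrm b;
  nrm_emb_mul : forall z a, nrm (amul (emb z) a) <= Cmod z * nrm a
}.

Declare Scope calg_scope.
Delimit Scope calg_scope with A.
Arguments azero {c}.
Arguments aone {c}.
Arguments aadd {c} _%_A _%_A.
Arguments amul {c} _%_A _%_A.
Arguments asub {c} _%_A _%_A.
Arguments aopp {c} _%_A.
Arguments emb {c} _%_C.
Arguments nrm {c} _%_A.
Arguments emb_1 {c}.
Arguments emb_add {c} _ _.
Arguments emb_mul {c} _ _.
Arguments nrm_ge0 {c} _.
Arguments nrm_1 {c}.
Arguments nrm_add {c} _ _.
Arguments nrm_mul {c} _ _.
Arguments nrm_emb_mul {c} _ _.
Notation "0" := azero : calg_scope.
Notation "1" := aone : calg_scope.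
Infix "+" := aadd : calg_scope.
Infix "*" := amul : calg_scope.
Infix "-" := asub : calg_scope.
Notation "- x" := (aopp x) : calg_scope.

Fixpoint apow {A : comm_normed_alg} (a : A) (n : nat) : A :=
  match n with O => 1%A | S p => (a * apow a p)%A end.
Infix "^" := apow : calg_scope.

Fixpoint asum {A : comm_normed_alg} (f : nat -> A) (n : nat) : A :=
  match n with O => 0%A | S p => (asum f p + f p)%A end.

Fixpoint rsum (f : nat -> R) (n : nat) : R :=
  match n with O => 0 | S p => rsum f p + f p end.

Lemma rsum_le f g n :
  (forall j, (j < n)%nat -> f j <= g j) -> rsum f n <= rsum g n.
Proof.
  induction n as [|n IH]; intros H; simpl; [lra|].
  assert (f n <= g n) by (apply H; lia).
  assert (rsum f n <= rsum g n) by (apply IH; intros; apply H; lia). lra.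
Qed.

Lemma rsum_scal c f n : rsum (fun j => c * f j) n = c * rsum f n.
Proof. induction n; simpl; [ring|]. rewrite IHn; ring. Qed.

Lemma rsum_plus f g n : rsum (fun j => f j + g j) n = rsum f n + rsum g n.
Proof. induction n; simpl; [ring|]. rewrite IHn; ring. Qed.

Lemma rsum_const c n : rsum (fun _ => c) n = INR n * c.
Proof. induction n; [simpl; ring|]. rewrite S_INR; simpl; rewrite IHn; ring. Qed.

Lemma rsum_S f n : rsum f (S n) = f O + rsum (fun j => f (S j)) n.
Proof. induction n; simpl in *; [ring|]. rewrite IHn; ring. Qed.

Lemma rsum_rev f n : rsum (fun j => f (n - 1 - j)%nat) n = rsum f n.
Proof.
  induction n; [reflexivity|].
  rewrite rsum_S. replace (S n - 1 - 0)%nat with n by lia. simpl. rewrite Rplus_comm. f_equal.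
  rewrite <- IHn. clear IHn.
  assert (forall m, (m <= n)%nat -> rsum (fun j => f (n - 0 - S j)%nat) m
     = rsum (fun j => f (n - 1 - j)%nat) m) as E.
  { induction m; intros Hm; simpl; [reflexivity|]. rewrite IHm by lia. do 2 f_equal; lia. }
  apply E; lia.
Qed.

Section Algebra.
Context {A : comm_normed_alg}.
Add Ring calg_ring_inst : (calg_ring A).
Implicit Types a b T : A.

Lemma emb_0 : @emb A (RtoC 0) = 0%A.
Proof.
  assert (@emb A (RtoC 0) = emb (RtoC 0) + emb (RtoC 0))%A as E.
  { rewrite <- emb_add. f_equal. now rewrite Cplus_0_l. }
  assert (0 = emb (RtoC 0) - @emb A (RtoC 0))%A as F by ring.
  rewrite F. rewrite E at 2. ring.
Qed.

Lemma emb_opp z : @emb A (- z)%C = (- emb z)%A.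
Proof.
  assert (emb z + emb (- z)%C = @azero A)%A as E.
  { rewrite <- emb_add, Cplus_opp_r. apply emb_0. }
  assert (@emb A (- z)%C = (emb z + emb (- z)%C) - emb z)%A as F by ring.
  rewrite F, E. ring.
Qed.

Lemma emb_sub y z : @emb A (y - z)%C = (emb y - emb z)%A.
Proof. unfold Cminus. rewrite emb_add, emb_opp. ring. Qed.

Lemma emb_pow z n : @emb A (z ^ n)%C = (emb z ^ n)%A.
Proof. induction n; simpl; [apply emb_1|]. now rewrite emb_mul, IHn. Qed.

Lemma nrm_0 : nrm (@azero A) = 0.
Proof.
  apply Rle_antisym; [|apply nrm_ge0].
  replace (@azero A) with (@emb A (RtoC 0) * 1)%A by (rewrite emb_0; ring).
  eapply Rle_trans; [apply nrm_emb_mul|]. rewrite Cmod_0. lra.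
Qed.

Lemma nrm_opp a : nrm (- a) <= nrm a.
Proof.
  replace (- a)%A with (emb (- RtoC 1)%C * a)%A.
  - eapply Rle_trans; [apply nrm_emb_mul|]. rewrite Cmod_m1. lra.
  - rewrite emb_opp, emb_1. ring.
Qed.

Lemma nrm_sub a b : nrm (a - b) <= nrm a + nrm b.
Proof.
  replace (a - b)%A with (a + - b)%A by ring.
  eapply Rle_trans; [apply nrm_add|]. pose proof (nrm_opp b). lra.
Qed.

Lemma nrm_mul_le a b x y : nrm a <= x -> nrm b <= y -> nrm (a * b) <= x * y.
Proof.
  intros Ha Hb. eapply Rle_trans; [apply nrm_mul|].
  apply Rmult_le_compat; auto using nrm_ge0.
Qed.

Lemma nrm_emb_mul_le z a x y : Cmod z <= x -> nrm a <= y -> nrm (emb z * a) <= x * y.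
Proof.
  intros Ha Hb. eapply Rle_trans; [apply nrm_emb_mul|].
  apply Rmult_le_compat; auto using nrm_ge0, Cmod_ge_0.
Qed.

Lemma nrm_pow a n : nrm (a ^ n) <= nrm a ^ n.
Proof. induction n; simpl; [apply nrm_1|]. apply nrm_mul_le; lra. Qed.

Lemma asum_ext (f g : nat -> A) n :
  (forall j, (j < n)%nat -> f j = g j) -> asum f n = asum g n.
Proof.
  induction n; intros H; simpl; [reflexivity|].
  rewrite H, IHn; [reflexivity| |]; intros; try apply H; lia.
Qed.

Lemma asum_add (f g : nat -> A) n : (asum (fun j => f j + g j) n = asum f n + asum g n)%A.
Proof. induction n; simpl; [ring|]. rewrite IHn; ring. Qed.

Lemma asum_sub (f g : nat -> A) n : (asum (fun j => f j - g j) n = asum f n - asum g n)%A.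
Proof. induction n; simpl; [ring|]. rewrite IHn; ring. Qed.

Lemma asum_mul (c : A) f n : (asum (fun j => c * f j) n = c * asum f n)%A.
Proof. induction n; simpl; [ring|]. rewrite IHn; ring. Qed.

Lemma asum_const (c : A) n : (asum (fun _ => c) n = emb (RtoC (INR n)) * c)%A.
Proof.
  induction n.
  - simpl asum. change (INR 0) with 0. rewrite emb_0. ring.
  - rewrite S_INR, RtoC_plus, emb_add, emb_1. simpl asum. rewrite IHn. ring.
Qed.

Lemma asum_split (f : nat -> A) m n :
  (asum f (m + n) = asum f m + asum (fun j => f (m + j)%nat) n)%A.
Proof.
  induction n; simpl; [rewrite Nat.add_0_r; ring|].
  rewrite Nat.add_succ_r; simpl. rewrite IHn. ring.
Qed.

Lemma nrm_asum (f : nat -> A) n : nrm (asum f n) <= rsum (fun j => nrm (f j)) n.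
Proof.
  induction n; simpl; [rewrite nrm_0; lra|].
  eapply Rle_trans; [apply nrm_add|]. lra.
Qed.

(* The Neumann series bound; as the inverse [b] is given, completeness is not used. *)
Lemma nrm_inv_near_1 u b q :
  (u * b = 1)%A -> nrm (u - 1) <= q -> q < 1 -> nrm b <= / (1 - q).
Proof.
  intros E H Hq.
  assert (b = 1 - (u - 1) * b)%A as F by (rewrite <- E at 1; ring).
  assert (nrm b <= 1 + q * nrm b) as G.
  { rewrite F at 1. eapply Rle_trans; [apply nrm_sub|].
    apply Rplus_le_compat; [apply nrm_1|]. apply nrm_mul_le; lra. }
  apply Rmult_le_reg_l with (1 - q); [lra|]. rewrite Rinv_r by lra. lra.
Qed.

End Algebra.

(** * Points of the unit circle and roots of unity *)

Definition cis (t : R) : Complex.C := (cos t, sin t).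

Lemma cis_add s t : cis (s + t) = (cis s * cis t)%C.
Proof. unfold cis, Cmult; simpl. rewrite cos_plus, sin_plus. f_equal; ring. Qed.

Lemma cis_0 : cis 0 = 1%C.
Proof. unfold cis. now rewrite cos_0, sin_0. Qed.

Lemma Cmod_cis t : Cmod (cis t) = 1.
Proof.
  unfold Cmod, cis; simpl.
  pose proof (sin2_cos2 t) as E. unfold Rsqr in E.
  replace (cos t * (cos t * 1) + sin t * (sin t * 1)) with 1 by lra. apply sqrt_1.
Qed.

Lemma cis_pow t n : (cis t ^ n)%C = cis (INR n * t).
Proof.
  induction n; [simpl; now rewrite Rmult_0_l, cis_0|].
  rewrite S_INR; simpl. rewrite IHn, <- cis_add. f_equal; ring.
Qed.

Lemma cis_2PI n : cis (INR n * (2 * PI)) = 1%C.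
Proof.
  rewrite <- cis_pow. unfold cis. rewrite cos_2PI, sin_2PI. apply Cpow_1_l.
Qed.

Lemma Cmod_cis_sub_1 t : Cmod (cis t - 1) = 2 * Rabs (sin (t / 2)).
Proof.
  replace (2 * Rabs (sin (t / 2))) with (Rabs (2 * sin (t / 2)))
    by (rewrite Rabs_mult, (Rabs_right 2); lra).
  rewrite <- sqrt_Rsqr_abs. unfold Cmod. f_equal. unfold Rsqr, cis; simpl.
  assert (cos t = 1 - 2 * sin (t/2) * sin (t/2)) as E1.
  { rewrite <- cos_2a_sin. f_equal; lra. }
  assert (sin t = 2 * sin (t/2) * cos (t/2)) as E2.
  { rewrite <- sin_2a. f_equal; lra. }
  rewrite E1, E2. pose proof (sin2_cos2 (t/2)) as E. unfold Rsqr in E.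
  set (s := sin (t/2)) in *. set (c := cos (t/2)) in *.
  replace (2 * s * c + - 0) with (2 * s * c) by ring.
  transitivity (4 * s * s * (s * s + c * c)); [ring|rewrite E; ring].
Qed.

Lemma Cmod_cis_sub_1_le t : Cmod (cis t - 1) <= Rabs t.
Proof.
  rewrite Cmod_cis_sub_1.
  assert (forall x, 0 <= x -> Rabs (sin x) <= x) as H.
  { intros x Hx. destruct (Req_dec x 0) as [->|]; [rewrite sin_0, Rabs_R0; lra|].
    destruct (Rle_dec x 1).
    - pose proof (sin_lt_x x). pose proof PI2_1.
      rewrite Rabs_right; [lra|]. apply Rle_ge, sin_ge_0; lra.
    - apply Rle_trans with 1; [|lra]. apply Rabs_le. apply SIN_bound. }
  destruct (Rle_dec 0 t).
  - pose proof (H (t/2)). rewrite (Rabs_right t) by lra. lra.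
  - pose proof (H (-t/2)) as G. replace (- t / 2) with (- (t / 2)) in G by lra.
    rewrite sin_neg, Rabs_Ropp in G. rewrite (Rabs_left t) by lra. lra.
Qed.

(** A weak Jordan inequality: the Taylor minorant of degree 7, rearranged so that both correction
    terms are visibly nonnegative for x <= 2, a range that PI <= 4 already covers. *)
Lemma sin_lower x : 0 <= x -> x <= PI / 2 -> x / 3 <= sin x.
Proof.
  intros H0 H1. pose proof PI_4. pose proof PI_RGT_0.
  assert (x <= 2) as Hx2 by lra.
  destruct (SIN x H0) as [L _]; [lra|].
  eapply Rle_trans; [|exact L].
  unfold sin_lb, sin_approx, sin_term; simpl.
  match goal with |- _ <= ?e => replace e with
    (x / 3 + x * ((2 / 3) * (1 - x * x / 4) + (x*x) * (x*x) * (42 - x * x) / 5040)) by field end.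
  assert (0 <= 1 - x * x / 4) by nra. assert (0 <= 42 - x * x) by nra.
  assert (0 <= (x*x) * (x*x) * (42 - x * x) / 5040).
  { apply Rmult_le_pos; [|lra]. apply Rmult_le_pos; [|lra]. nra. }
  nra.
Qed.

Definition pnt (r : R) (N j : nat) : Complex.C := (RtoC r * cis (2 * PI * INR j / INR N))%C.

Lemma Cmod_pnt r N j : 0 <= r -> Cmod (pnt r N j) = r.
Proof. intros. unfold pnt. rewrite Cmod_mult, Cmod_R, Cmod_cis, Rabs_right; lra. Qed.

(** The chord is 2 sin(pi j / N), and pi >= 3 turns [sin_lower] into sin(pi y) >= y for y <= 1/2.
    Past the half circle, reflection exchanges [j] and [N - j]; the minimum is the cyclic distance
    of the index from 0. *)
Lemma cis_root_far N j : (0 < N)%nat -> (j <= N)%nat ->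
  2 * INR (Nat.min j (N - j)) / INR N <= Cmod (cis (2 * PI * INR j / INR N) - 1).
Proof.
  intros HN Hj. rewrite Cmod_cis_sub_1.
  replace (2 * PI * INR j / INR N / 2) with (PI * (INR j / INR N)) by (field; apply not_0_INR; lia).
  assert (0 < INR N) by (apply lt_0_INR; lia).
  assert (0 <= INR j <= INR N) by (split; [apply pos_INR|apply le_INR; lia]).
  pose proof PI2_3_2. pose proof PI_RGT_0.
  assert (forall y, 0 <= y <= /2 -> y <= sin (PI * y)) as S.
  { intros y Hy. eapply Rle_trans; [|apply sin_lower; nra]. nra. }
  assert (0 <= INR j / INR N) by (apply Rmult_le_pos; [lra|apply Rlt_le, Rinv_0_lt_compat; lra]).
  assert (INR j / INR N <= 1).
  { apply Rmult_le_reg_r with (INR N); [lra|]. unfold Rdiv; rewrite Rmult_assoc, Rinv_l; lra. }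
  rewrite Rabs_right by (apply Rle_ge, sin_ge_0; nra).
  destruct (Rle_dec (INR j / INR N) (/2)) as [L|L].
  - apply Rle_trans with (2 * (INR j / INR N)).
    + unfold Rdiv; rewrite Rmult_assoc. apply Rmult_le_compat_l; [lra|].
      apply Rmult_le_compat_r; [apply Rlt_le, Rinv_0_lt_compat; lra|]. apply le_INR; lia.
    + apply Rmult_le_compat_l; [lra|]. apply S; lra.
  - rewrite <- sin_PI_x. replace (PI - PI * (INR j / INR N)) with (PI * (1 - INR j / INR N)) by ring.
    apply Rle_trans with (2 * (1 - INR j / INR N)).
    + replace (1 - INR j / INR N) with ((INR N - INR j) / INR N) by (field; lra).
      unfold Rdiv; rewrite Rmult_assoc. apply Rmult_le_compat_l; [lra|].
      apply Rmult_le_compat_r; [apply Rlt_le, Rinv_0_lt_compat; lra|].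
      rewrite <- minus_INR by lia. apply le_INR; lia.
    + apply Rmult_le_compat_l; [lra|]. apply S; lra.
Qed.

Lemma cis_root_near N j : (0 < N)%nat -> (j <= N)%nat ->
  Cmod (cis (2 * PI * INR j / INR N) - 1) <= 8 * INR (Nat.min j (N - j)) / INR N.
Proof.
  intros HN Hj.
  assert (0 < INR N) by (apply lt_0_INR; lia).
  pose proof PI_4. pose proof PI_RGT_0.
  assert (forall i, Cmod (cis (2 * PI * INR i / INR N) - 1) <= 8 * INR i / INR N) as H2.
  { intros i. eapply Rle_trans; [apply Cmod_cis_sub_1_le|].
    pose proof (pos_INR i). assert (0 < / INR N) by (apply Rinv_0_lt_compat; lra).
    assert (0 <= INR i * / INR N) by (apply Rmult_le_pos; lra).
    unfold Rdiv. rewrite Rabs_right by (apply Rle_ge; rewrite Rmult_assoc; nra).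
    apply Rmult_le_compat_r; [lra|]. nra. }
  destruct (Nat.min_spec j (N - j)) as [[_ ->]|[_ ->]]; [apply H2|].
  eapply Rle_trans; [|apply H2]. right. rewrite !Cmod_cis_sub_1. f_equal.
  rewrite minus_INR by lia.
  replace (2 * PI * (INR N - INR j) / INR N / 2) with (PI - 2 * PI * INR j / INR N / 2) by (field; lra).
  now rewrite sin_PI_x.
Qed.

Lemma pnt_S r N j : pnt r N (S j) = (cis (2 * PI / INR N) * pnt r N j)%C.
Proof.
  unfold pnt. rewrite S_INR.
  replace (2 * PI * (INR j + 1) / INR N) with (2 * PI / INR N + 2 * PI * INR j / INR N)
    by (unfold Rdiv; ring).
  rewrite cis_add. ring.
Qed.

Lemma pnt_pow r N j q :
  (pnt r N j ^ q)%C = (RtoC (r ^ q) * cis (2 * PI * INR q / INR N) ^ j)%C.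
Proof.
  unfold pnt. rewrite Cpow_mult_l, RtoC_pow, !cis_pow. do 2 f_equal. unfold Rdiv; ring.
Qed.

Lemma pnt_pow_N r N j : (0 < N)%nat -> (pnt r N j ^ N)%C = RtoC (r ^ N).
Proof.
  intros HN. rewrite pnt_pow, cis_pow.
  replace (INR j * (2 * PI * INR N / INR N)) with (INR j * (2 * PI))
    by (field; apply not_0_INR; lia).
  rewrite cis_2PI. ring.
Qed.

(** * The discrete Cauchy formula *)

Section Average.
Context {A : comm_normed_alg}.
Local Notation emb := (@emb A).
Add Ring calg_ring_inst2 : (calg_ring A).

Lemma asum_geom (u : Complex.C) n :
  (asum (fun j => emb (u ^ j)%C) n * (emb u - 1) = emb (u ^ n)%C - 1)%A.
Proof.
  induction n; simpl.
  - rewrite emb_1; ring.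
  - rewrite emb_mul.
    transitivity (asum (fun j => emb (u ^ j)%C) n * (emb u - 1) + emb (u ^ n)%C * (emb u - 1))%A; [ring|].
    rewrite IHn. ring.
Qed.

Lemma asum_pnt_pow r N q : (0 < q)%nat -> (q < N)%nat ->
  asum (fun j => emb (pnt r N j ^ q)%C) N = 0%A.
Proof.
  intros Hq HN. set (u := cis (2 * PI * INR q / INR N)).
  assert (u - 1 <> 0)%C as Hu.
  { apply Cmod_gt_0. eapply Rlt_le_trans; [|apply cis_root_far; lia].
    assert (0 < INR N) by (apply lt_0_INR; lia).
    assert (0 < INR (Nat.min q (N - q))) by (apply lt_0_INR; lia).
    apply Rmult_lt_0_compat; [lra|apply Rinv_0_lt_compat; lra]. }
  rewrite (asum_ext _ (fun j => (emb (RtoC (r ^ q)) * emb (u ^ j)%C)%A))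
    by (intros; rewrite pnt_pow; apply emb_mul).
  rewrite asum_mul.
  assert (asum (fun j => emb (u ^ j)) N = 0%A) as E; [|rewrite E; ring].
  pose proof (asum_geom u N) as G.
  replace (u ^ N)%C with (RtoC 1) in G.
  2:{ unfold u. rewrite cis_pow.
      replace (INR N * (2 * PI * INR q / INR N)) with (INR q * (2 * PI))
        by (field; apply not_0_INR; lia). now rewrite cis_2PI. }
  set (X := asum _ _) in *.
  transitivity (X * (emb u - 1) * emb (/ (u - RtoC 1))%C)%A.
  - rewrite <- (@emb_1 A), <- emb_sub.
    transitivity (X * (emb (u - RtoC 1)%C * emb (/ (u - RtoC 1))%C))%A; [|ring].
    rewrite <- emb_mul, Cinv_r by assumption. rewrite emb_1. ring.
  - rewrite G, emb_1. ring.
Qed.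

Context (T : A) (Res : Complex.C -> A).
Context (HRes : forall z, 1 < Cmod z -> ((emb z - T) * Res z = 1)%A).

(** The polynomial quotient (z^p - T^p) / (z - T), in Horner form. *)
Fixpoint geo (z : Complex.C) (p : nat) : A :=
  match p with O => 0%A | S q => (emb z * geo z q + T ^ q)%A end.

Lemma geo_spec z p : ((emb z - T) * geo z p = emb (z ^ p)%C - T ^ p)%A.
Proof.
  induction p; simpl; [rewrite emb_1; ring|].
  rewrite emb_mul.
  transitivity (emb z * ((emb z - T) * geo z p) + (emb z - T) * T ^ p)%A; [ring|].
  rewrite IHp. ring.
Qed.

(** Among the monomials of [geo], only z^(p-1) is completed to z^N = r^N; every other one becomes a
    power of z strictly between 0 and N, which sums to zero. The case p = N is the one used, general
    p serves the induction. *)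
Lemma asum_geo r N p : (0 < p)%nat -> (p <= N)%nat ->
  asum (fun j => emb (pnt r N j ^ (N + 1 - p))%C * geo (pnt r N j) p)%A N
  = (emb (RtoC (INR N)) * emb (RtoC (r ^ N)))%A.
Proof.
  induction p as [|p IH]; [lia|]. intros _ Hp.
  destruct p as [|p].
  - rewrite <- asum_const. apply asum_ext. intros j Hj. simpl geo.
    replace (N + 1 - 1)%nat with N by lia. rewrite pnt_pow_N by lia. ring.
  - rewrite <- IH by lia.
    transitivity (asum (fun j => emb (pnt r N j ^ (N + 1 - S p))%C * geo (pnt r N j) (S p)
                         + T ^ S p * emb (pnt r N j ^ (N - S p))%C)%A N).
    + apply asum_ext. intros j _.
      replace (N + 1 - S (S p))%nat with (N - S p)%nat by lia.
      replace (N + 1 - S p)%nat with (S (N - S p)) by lia.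
      rewrite Cpow_S, emb_mul. cbn [geo]. ring.
    + rewrite asum_add, asum_mul, asum_pnt_pow by lia. ring.
Qed.

(** The exponent is n + 1 because d lambda = i lambda d theta contributes one factor lambda on the
    circle. *)
Definition cauchy_sum (r : R) (N k n : nat) : A :=
  asum (fun j => emb (pnt r N j ^ (n + 1) * (RtoC 1 - pnt r N j) ^ k)%C * Res (pnt r N j))%A N.

(** Raising n uses lambda R = T R + 1, whose last term sums to zero as long as the exponent stays
    below N. Raising k splits off 1 - lambda and calls the formula at both n and n + 1; hence n is
    generalized and n + k must stay below N. *)
Lemma cauchy_sum_spec r N k n : 1 < r -> (n + k < N)%nat ->
  (cauchy_sum r N k n * (emb (RtoC (r ^ N)) - T ^ N)
   = emb (RtoC (INR N)) * emb (RtoC (r ^ N)) * (T ^ n * (1 - T) ^ k))%A.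
Proof.
  intros Hr. revert n. induction k as [|k IHk].
  - intros n. rewrite Nat.add_0_r. induction n as [|n IHn]; intros Hn.
    + rewrite <- (asum_geo r N N) by lia. simpl apow.
      transitivity (asum (fun j => (emb (RtoC (r ^ N)) - T ^ N) *
        (emb (pnt r N j ^ (0 + 1) * (RtoC 1 - pnt r N j) ^ 0)%C * Res (pnt r N j)))%A N).
      * rewrite asum_mul. unfold cauchy_sum. ring.
      * transitivity (asum (fun j => emb (pnt r N j ^ (N + 1 - N))%C * geo (pnt r N j) N)%A N); [|ring].
        apply asum_ext. intros j _.
        replace (N + 1 - N)%nat with 1%nat by lia.
        (* At every sample point r^N = lambda^N, so r^N - T^N is divisible by lambda - T and the
           resolvent cancels, leaving [geo]. *)
        rewrite <- (pnt_pow_N r N j), <- geo_spec by lia.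
        assert ((emb (pnt r N j) - T) * Res (pnt r N j) = 1)%A as E
          by (apply HRes; rewrite Cmod_pnt; lra).
        simpl. rewrite !Cmult_1_r.
        transitivity (emb (pnt r N j) * geo (pnt r N j) N * ((emb (pnt r N j) - T) * Res (pnt r N j)))%A;
          [ring|rewrite E; ring].
    + assert (cauchy_sum r N 0 (S n) = T * cauchy_sum r N 0 n)%A as E.
      { transitivity (T * cauchy_sum r N 0 n + asum (fun j => emb (pnt r N j ^ (n + 1))%C) N)%A.
        - unfold cauchy_sum. rewrite <- asum_mul, <- asum_add. apply asum_ext. intros j _.
          assert ((emb (pnt r N j) - T) * Res (pnt r N j) = 1)%A as E
            by (apply HRes; rewrite Cmod_pnt; lra).
          simpl. rewrite !Cmult_1_r, emb_mul.
          transitivity (T * (emb (pnt r N j ^ (n + 1))%C * Res (pnt r N j)) + emb (pnt r N j ^ (n + 1))%C * ((emb (pnt r N j) - T) * Res (pnt r N j)))%A; [ring|rewrite E; ring].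
        - rewrite asum_pnt_pow by lia. ring. }
      rewrite E. simpl apow in *.
      transitivity (T * (cauchy_sum r N 0 n * (emb (RtoC (r ^ N)) - T ^ N)))%A; [ring|].
      rewrite IHn by lia. ring.
  - intros n Hn.
    assert (cauchy_sum r N (S k) n = cauchy_sum r N k n - cauchy_sum r N k (S n))%A as E.
    { unfold cauchy_sum. rewrite <- asum_sub. apply asum_ext. intros j _.
      simpl. rewrite !emb_mul, emb_sub, emb_1. ring. }
    rewrite E.
    transitivity (cauchy_sum r N k n * (emb (RtoC (r ^ N)) - T ^ N)
      - cauchy_sum r N k (S n) * (emb (RtoC (r ^ N)) - T ^ N))%A; [ring|].
    rewrite !IHk by lia. simpl apow. ring.
Qed.

End Average.

(** * Growth of powers when the resolvent set contains the exterior of the disk *)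

Lemma cis_sub_le s t : Cmod (cis s - cis t) <= Rabs (s - t).
Proof.
  replace (cis s - cis t)%C with (cis t * (cis (s - t) - 1))%C.
  - rewrite Cmod_mult, Cmod_cis, Rmult_1_l. apply Cmod_cis_sub_1_le.
  - replace s with (t + (s - t)) at 2 by ring. rewrite cis_add. ring.
Qed.

Section Rickart.
Context {A : comm_normed_alg}.
Add Ring calg_ring_inst3 : (calg_ring A).
Local Notation emb := (@emb A).
Context (T : A) (Res : Complex.C -> A).
Context (HRes : forall z, 1 < Cmod z -> ((emb z - T) * Res z = 1)%A).

Lemma res_diff y z : 1 < Cmod y -> 1 < Cmod z ->
  (Res y - Res z = emb (z - y)%C * (Res y * Res z))%A.
Proof.
  intros Hy Hz. apply HRes in Hy, Hz. rewrite emb_sub.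
  transitivity (Res y * ((emb z - T) * Res z) - Res z * ((emb y - T) * Res y))%A.
  - rewrite Hy, Hz. ring.
  - ring.
Qed.

(** The resolvent identity bounds the norm of [Res y] by b plus half of itself, and the half is
    absorbed on the left. *)
Lemma res_near y z b : 1 < Cmod y -> 1 < Cmod z ->
  nrm (Res z) <= b -> Cmod (y - z) * b <= / 2 -> nrm (Res y) <= 2 * b.
Proof.
  intros Hy Hz Hb H.
  assert (Res y = Res z + emb (z - y)%C * (Res y * Res z))%A as E
    by (rewrite <- res_diff by assumption; ring).
  assert (nrm (Res y) <= b + nrm (Res y) * / 2) as G; [|lra].
  rewrite E at 1. eapply Rle_trans; [apply nrm_add|]. apply Rplus_le_compat; [assumption|].
  eapply Rle_trans; [apply nrm_emb_mul|].
  replace (z - y)%C with (- (y - z))%C by ring. rewrite Cmod_opp.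
  pose proof (nrm_mul (Res y) (Res z)). pose proof (nrm_ge0 (Res y)).
  pose proof (Cmod_ge_0 (y - z)).
  apply Rle_trans with (Cmod (y - z) * (nrm (Res y) * b)).
  - apply Rmult_le_compat_l; [assumption|]. eapply Rle_trans; [eassumption|].
    apply Rmult_le_compat_l; assumption.
  - replace (Cmod (y - z) * (nrm (Res y) * b)) with (nrm (Res y) * (Cmod (y - z) * b)) by ring.
    apply Rmult_le_compat_l; assumption.
Qed.

Lemma res_diff_le y z b c e : 1 < Cmod y -> 1 < Cmod z ->
  nrm (Res y) <= b -> nrm (Res z) <= c -> Cmod (y - z) <= e ->
  nrm (Res y - Res z) <= e * (b * c).
Proof.
  intros Hy Hz Hb Hc He. rewrite res_diff by assumption.
  apply nrm_emb_mul_le; [|now apply nrm_mul_le].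
  replace (z - y)%C with (- (y - z))%C by ring. now rewrite Cmod_opp.
Qed.

Lemma Cmod_circle r t : 0 < r -> Cmod (RtoC r * cis t) = r.
Proof. intros. rewrite Cmod_mult, Cmod_R, Cmod_cis, Rabs_right; lra. Qed.

Lemma res_circle_bounded r : 1 < r ->
  exists B, 0 < B /\ forall t, 0 <= t <= 2 * PI -> nrm (Res (RtoC r * cis t)%C) <= B.
Proof.
  intros Hr. pose proof PI_RGT_0.
  destruct (continuity_ab_maj (fun t => nrm (Res (RtoC r * cis t)%C)) 0 (2 * PI)) as [t0 [Ht0 _]].
  - lra.
  - intros c _ eps Heps.
    set (b := nrm (Res (RtoC r * cis c)%C)). pose proof (nrm_ge0 (Res (RtoC r * cis c)%C)) as Hb.
    fold b in Hb.
    assert (0 < / (2 * r * (b + 1))) as P1 by (apply Rinv_0_lt_compat; nra).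
    assert (0 < / (4 * r * (b + 1) * (b + 1))) as P2
      by (apply Rinv_0_lt_compat; repeat apply Rmult_lt_0_compat; lra).
    (* The first radius makes [res_near] applicable, so the resolvent is at most 2b nearby; the
       second then makes r |x - c| 2b^2 less than eps. Using b + 1 keeps the denominators positive
       when b = 0. *)
    exists (Rmin (/ (2 * r * (b + 1))) (eps * / (4 * r * (b + 1) * (b + 1)))). split.
    { apply Rmin_pos; [assumption|]. apply Rmult_lt_0_compat; assumption. }
    intros x [_ Hx]. simpl in *. unfold R_dist in *.
    assert (Rabs (x - c) <= / (2 * r * (b + 1))) as H1
      by (eapply Rle_trans; [apply Rlt_le, Hx|apply Rmin_l]).
    assert (Rabs (x - c) < eps * / (4 * r * (b + 1) * (b + 1))) as H2
      by (eapply Rlt_le_trans; [apply Hx|apply Rmin_r]).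
    pose proof (Rabs_pos (x - c)) as H3.
    assert (Cmod (RtoC r * cis x - RtoC r * cis c) <= r * Rabs (x - c)) as H4.
    { replace (RtoC r * cis x - RtoC r * cis c)%C with (RtoC r * (cis x - cis c))%C by ring.
      rewrite Cmod_mult, Cmod_R, Rabs_right by lra.
      apply Rmult_le_compat_l; [lra|apply cis_sub_le]. }
    assert (r * Rabs (x - c) * (2 * (b + 1)) <= 1) as H5.
    { apply Rmult_le_reg_r with (/ (2 * r * (b + 1))); [assumption|].
      rewrite Rmult_1_l. apply Rle_trans with (Rabs (x - c)); [|assumption].
      right. field. split; lra. }
    assert (nrm (Res (RtoC r * cis x)%C) <= 2 * b) as H6.
    { apply res_near with (RtoC r * cis c)%C; try (rewrite Cmod_circle; lra).
      - unfold b; lra.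
      - apply Rle_trans with (r * Rabs (x - c) * b); [apply Rmult_le_compat_r; lra|].
        assert (0 <= r * Rabs (x - c)) by (apply Rmult_le_pos; lra). nra. }
    set (y := Res (RtoC r * cis x)%C) in *. set (z := Res (RtoC r * cis c)%C) in *.
    assert (nrm (y - z) < eps) as H7.
    { apply Rle_lt_trans with (r * Rabs (x - c) * (2 * b * b)).
      - apply res_diff_le; try (rewrite Cmod_circle; lra); try assumption. fold z; unfold b; lra.
      - apply Rle_lt_trans with (Rabs (x - c) * (4 * r * (b + 1) * (b + 1))).
        + replace (r * Rabs (x - c) * (2 * b * b)) with (Rabs (x - c) * (2 * r * b * b)) by ring.
          apply Rmult_le_compat_l; [assumption|].
          assert (0 <= r * b) by nra. nra.
        + apply Rlt_le_trans with (eps * / (4 * r * (b + 1) * (b + 1)) * (4 * r * (b + 1) * (b + 1))).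
          * apply Rmult_lt_compat_r; [|assumption]. repeat apply Rmult_lt_0_compat; lra.
          * right. field. split; lra. }
    assert (nrm y <= nrm z + nrm (y - z)) as H8.
    { replace y with (z + (y - z))%A at 1 by ring. apply nrm_add. }
    assert (nrm z <= nrm y + nrm (y - z)) as H9.
    { replace z with (y - (y - z))%A at 1 by ring. apply nrm_sub. }
    unfold b. apply Rabs_lt_between. lra.
  - exists (nrm (Res (RtoC r * cis t0)%C) + 1). split.
    + pose proof (nrm_ge0 (Res (RtoC r * cis t0)%C)). lra.
    + intros t Ht. specialize (Ht0 t Ht). simpl in Ht0. lra.
Qed.

Definition avg (r : R) (N k n : nat) : A := (emb (RtoC (/ INR N)) * cauchy_sum Res r N k n)%A.

Lemma avg_spec r N k n : 1 < r -> (n + k < N)%nat ->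
  (avg r N k n * (1 - emb (RtoC (/ r ^ N)) * T ^ N) = T ^ n * (1 - T) ^ k)%A.
Proof.
  intros Hr HN. pose proof (cauchy_sum_spec T Res HRes r N k n Hr HN) as E. unfold avg.
  assert (emb (RtoC (/ INR N)) * emb (RtoC (INR N)) = 1)%A as E1.
  { rewrite <- emb_mul, <- RtoC_mult, Rinv_l by (apply not_0_INR; lia). apply emb_1. }
  assert (emb (RtoC (/ r ^ N)) * emb (RtoC (r ^ N)) = 1)%A as E2.
  { rewrite <- emb_mul, <- RtoC_mult, Rinv_l by (apply pow_nonzero; lra). apply emb_1. }
  transitivity (emb (RtoC (/ INR N)) * emb (RtoC (/ r ^ N)) *
    (cauchy_sum Res r N k n * (emb (RtoC (r ^ N)) - T ^ N)))%A.
  - transitivity (emb (RtoC (/ INR N)) * (cauchy_sum Res r N k n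
      * ((emb (RtoC (/ r ^ N)) * emb (RtoC (r ^ N))) - emb (RtoC (/ r ^ N)) * T ^ N)))%A;
      [rewrite E2|]; ring.
  - rewrite E.
    transitivity ((emb (RtoC (/ INR N)) * emb (RtoC (INR N))) * (emb (RtoC (/ r ^ N)) * emb (RtoC (r ^ N)))
      * (T ^ n * (1 - T) ^ k))%A; [ring|]. rewrite E1, E2. ring.
Qed.

(** Uniformity in [N] is automatic, because the comparison is made summand by summand along each
    ray, on an annulus where the resolvent is bounded. *)
Lemma avg_equicontinuous r0 : 1 < r0 -> exists eta, 0 < eta /\ 1 < r0 - eta /\
  forall r r' N, r0 - eta <= r <= r0 + eta -> r0 - eta <= r' <= r0 + eta -> (0 < N)%nat ->
  nrm (avg r N 0 0 - avg r' N 0 0) <= / 4.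
Proof.
  intros Hr0. destruct (res_circle_bounded r0 Hr0) as [B [HB HBt]].
  pose proof (nrm_ge0 T) as HT. pose proof PI_RGT_0 as HPI.
  (* The three entries keep the annulus outside the closed unit disk, bound the resolvent there by
     2B through [res_near], and make the final bound [nrm T] (2m) (2B)^2 at most 1/4. *)
  set (m := Rmin ((r0 - 1) / 2) (Rmin (/ (2 * B)) (/ (32 * (B * B) * (nrm T + 1))))).
  assert (0 < / (2 * B)) by (apply Rinv_0_lt_compat; lra).
  assert (0 < B * B) by nra.
  assert (0 < 32 * (B * B) * (nrm T + 1)) by (apply Rmult_lt_0_compat; lra).
  assert (0 < / (32 * (B * B) * (nrm T + 1))) by (apply Rinv_0_lt_compat; lra).
  assert (0 < m) as Hm by (repeat apply Rmin_pos; lra).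
  assert (m <= (r0 - 1) / 2) as M1 by apply Rmin_l.
  assert (m * (2 * B) <= 1) as M2.
  { apply Rle_trans with (/ (2 * B) * (2 * B)); [|right; field; lra].
    apply Rmult_le_compat_r; [lra|]. eapply Rle_trans; [apply Rmin_r|apply Rmin_l]. }
  assert (m * (32 * (B * B) * (nrm T + 1)) <= 1) as M3.
  { apply Rle_trans with (/ (32 * (B * B) * (nrm T + 1)) * (32 * (B * B) * (nrm T + 1))); [|right; apply Rinv_l; lra].
    apply Rmult_le_compat_r; [lra|]. eapply Rle_trans; [apply Rmin_r|apply Rmin_r]. }
  exists m. split; [assumption|]. split; [lra|].
  intros r r' N Hr Hr' HN.
  assert (0 < INR N) as HNR by (apply lt_0_INR; lia).
  unfold avg.
  replace (emb (RtoC (/ INR N)) * cauchy_sum Res r N 0 0 - emb (RtoC (/ INR N)) * cauchy_sum Res r' N 0 0)%A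
    with (emb (RtoC (/ INR N)) * (cauchy_sum Res r N 0 0 - cauchy_sum Res r' N 0 0))%A by ring.
  apply Rle_trans with (/ INR N * (INR N * / 4)); [|right; field; lra].
  apply nrm_emb_mul_le.
  { rewrite Cmod_R, Rabs_right; [lra|]. apply Rle_ge, Rlt_le, Rinv_0_lt_compat; lra. }
  unfold cauchy_sum. rewrite <- asum_sub.
  eapply Rle_trans; [apply nrm_asum|]. rewrite <- rsum_const. apply rsum_le. intros j Hj.
  set (t := 2 * PI * INR j / INR N).
  assert (0 <= t <= 2 * PI) as Ht.
  { assert (INR j <= INR N) by (apply le_INR; lia). pose proof (pos_INR j).
    unfold t; split.
    - apply Rmult_le_pos; [apply Rmult_le_pos; lra|apply Rlt_le, Rinv_0_lt_compat; lra].
    - apply Rmult_le_reg_r with (INR N); [lra|]. unfold Rdiv; rewrite Rmult_assoc, Rinv_l by lra.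
      nra. }
  assert (forall q, r0 - m <= q <= r0 + m -> 1 < Cmod (RtoC q * cis t)
    /\ nrm (Res (RtoC q * cis t)%C) <= 2 * B) as Hq.
  { intros q Hq. rewrite Cmod_circle by lra. split; [lra|].
    apply res_near with (RtoC r0 * cis t)%C.
    - rewrite Cmod_circle; lra.
    - rewrite Cmod_circle; lra.
    - now apply HBt.
    - replace (RtoC q * cis t - RtoC r0 * cis t)%C with (RtoC (q - r0) * cis t)%C
        by (rewrite RtoC_minus; ring).
      rewrite Cmod_mult, Cmod_R, Cmod_cis, Rmult_1_r.
      apply Rle_trans with (m * B); [|lra]. apply Rmult_le_compat_r; [lra|]. apply Rabs_le; lra. }
  destruct (Hq r Hr) as [G1 G2]. destruct (Hq r' Hr') as [G3 G4].
  unfold pnt. fold t. set (y := (RtoC r * cis t)%C) in *. set (z := (RtoC r' * cis t)%C) in *.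
  (* Since lambda R(lambda) = 1 + T R(lambda), the scalar factors disappear and only a difference of
     resolvents remains. *)
  replace (emb (y ^ (0 + 1) * (RtoC 1 - y) ^ 0)%C * Res y - emb (z ^ (0 + 1) * (RtoC 1 - z) ^ 0)%C * Res z)%A
    with (T * (Res y - Res z))%A.
  2:{ simpl. rewrite !Cmult_1_r.
      transitivity ((1 + T * Res y) - (1 + T * Res z))%A; [ring|].
      rewrite <- (HRes y G1) at 1. rewrite <- (HRes z G3) at 1. ring. }
  apply Rle_trans with (nrm T * (2 * m * (2 * B * (2 * B)))).
  - apply nrm_mul_le; [lra|]. apply res_diff_le; try assumption.
    unfold y, z. replace (RtoC r * cis t - RtoC r' * cis t)%C with (RtoC (r - r') * cis t)%C
        by (rewrite RtoC_minus; ring).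
    rewrite Cmod_mult, Cmod_R, Cmod_cis, Rmult_1_r. apply Rabs_le; lra.
  - assert (0 <= m * (B * B)) by nra. nra.
Qed.

(** * Rickart's argument for the spectral radius *)

Definition growth_le (r : R) : Prop :=
  exists K N0, forall N, (N0 <= N)%nat -> nrm (T ^ N) <= K * r ^ N.

Lemma growth_le_lt r r' eps : 0 < r < r' -> 0 < eps -> growth_le r ->
  exists N0, forall N, (N0 <= N)%nat -> nrm (T ^ N) <= eps * r' ^ N.
Proof.
  intros Hr He [K [N0 H]].
  assert (0 < Rabs K + 1) by (pose proof (Rabs_pos K); lra).
  destruct (pow_lt_1_zero (r / r')) with (y := eps / (Rabs K + 1)) as [N1 H1].
  - rewrite Rabs_right.
    + apply Rmult_lt_reg_r with r'; [lra|]. unfold Rdiv; rewrite Rmult_assoc, Rinv_l; lra.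
    + apply Rle_ge, Rmult_le_pos; [lra|apply Rlt_le, Rinv_0_lt_compat; lra].
  - apply Rdiv_lt_0_compat; lra.
  - exists (max N0 N1). intros N HN.
    eapply Rle_trans; [apply H; lia|].
    specialize (H1 N ltac:(lia)).
    assert (0 < r' ^ N) by (apply pow_lt; lra). assert (0 < r ^ N) by (apply pow_lt; lra).
    rewrite Rabs_right in H1.
    2:{ apply Rle_ge, pow_le, Rmult_le_pos; [lra|apply Rlt_le, Rinv_0_lt_compat; lra]. }
    unfold Rdiv in H1 at 1. rewrite Rpow_mult_distr, pow_inv in H1.
    apply Rle_trans with (Rabs K * r ^ N); [apply Rmult_le_compat_r; [lra|apply Rle_abs]|].
    assert (r ^ N * (Rabs K + 1) < eps * r' ^ N).
    { apply Rmult_lt_reg_r with (/ r' ^ N * / (Rabs K + 1)).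
      - apply Rmult_lt_0_compat; apply Rinv_0_lt_compat; lra.
      - replace (r ^ N * (Rabs K + 1) * (/ r' ^ N * / (Rabs K + 1))) with (r ^ N * / r' ^ N) by (field; lra).
        replace (eps * r' ^ N * (/ r' ^ N * / (Rabs K + 1))) with (eps / (Rabs K + 1)) by (field; lra).
        assumption. }
    lra.
Qed.

Lemma nrm_scaled_pow r N e : 0 < r -> nrm (T ^ N) <= e * r ^ N ->
  nrm (emb (RtoC (/ r ^ N)) * T ^ N) <= e.
Proof.
  intros Hr H. assert (0 < r ^ N) by (apply pow_lt; lra).
  apply Rle_trans with (/ r ^ N * (e * r ^ N)); [|right; field; lra].
  apply nrm_emb_mul_le; [|assumption].
  rewrite Cmod_R, Rabs_right; [lra|]. apply Rle_ge, Rlt_le, Rinv_0_lt_compat; lra.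
Qed.

(* Rickart's argument: [avg r N 0 0] is the inverse of [1 - r^-N T^N], so closeness of two averages
   transfers the smallness of [r'^-N T^N] into a bound for [r^-N T^N]. *)
Lemma growth_le_step r1 r r' : 0 < r1 < r' -> 1 < r -> 1 < r' ->
  (forall N, (0 < N)%nat -> nrm (avg r N 0 0 - avg r' N 0 0) <= / 4) ->
  growth_le r1 -> growth_le r.
Proof.
  intros Hr1 Hr Hr' Hav HG.
  destruct (growth_le_lt r1 r' (/ 4) Hr1 ltac:(lra) HG) as [N0 H].
  (* From 1/4 for the scaled power at r', its average is at most 4/3 and within 1/3 of 1; the
     average at r is within 1/3 + 1/4 = 7/12 of 1, its inverse is at most 12/5, and subtracting that
     inverse from 1 gives 17/5. *)
  exists (17 / 5), (S N0). intros N HN.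
  specialize (H N ltac:(lia)). specialize (Hav N ltac:(lia)).
  assert (avg r N 0 0 * (1 - emb (RtoC (/ r ^ N)) * T ^ N) = 1)%A as E
    by (rewrite avg_spec by (assumption || lia); simpl; ring).
  assert (avg r' N 0 0 * (1 - emb (RtoC (/ r' ^ N)) * T ^ N) = 1)%A as E'
    by (rewrite avg_spec by (assumption || lia); simpl; ring).
  apply nrm_scaled_pow in H; [|lra].
  set (x := (emb (RtoC (/ r ^ N)) * T ^ N)%A) in *.
  set (x' := (emb (RtoC (/ r' ^ N)) * T ^ N)%A) in *.
  set (u := avg r N 0 0) in *. set (u' := avg r' N 0 0) in *.
  assert (nrm u' <= / (1 - / 4)) as H1.
  { apply nrm_inv_near_1 with (1 - x')%A; [transitivity (u' * (1 - x'))%A; [ring|exact E']| |lra].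
    replace (1 - x' - 1)%A with (- x')%A by ring. eapply Rle_trans; [apply nrm_opp|assumption]. }
  assert (nrm (u' - 1) <= / (1 - / 4) * / 4) as H2.
  { replace (u' - 1)%A with (u' * x')%A by (rewrite <- E' at 1; ring). now apply nrm_mul_le. }
  assert (nrm (u - 1) <= 7 / 12) as H3.
  { replace (u - 1)%A with ((u - u') + (u' - 1))%A by ring.
    eapply Rle_trans; [apply nrm_add|]. lra. }
  assert (nrm (1 - x) <= / (1 - 7 / 12)) as H4 by (apply nrm_inv_near_1 with u; [assumption..|lra]).
  assert (nrm x <= 17 / 5) as H5.
  { replace x with (1 - (1 - x))%A by ring. eapply Rle_trans; [apply nrm_sub|].
    pose proof (@nrm_1 A). lra. }
  assert (0 < r ^ N) by (apply pow_lt; lra).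
  replace (T ^ N)%A with (emb (RtoC (r ^ N)) * x)%A.
  - rewrite Rmult_comm. apply nrm_emb_mul_le; [|assumption]. rewrite Cmod_R, Rabs_right; lra.
  - unfold x. transitivity ((emb (RtoC (r ^ N)) * emb (RtoC (/ r ^ N))) * T ^ N)%A; [ring|].
    rewrite <- emb_mul, <- RtoC_mult, Rinv_r by lra. rewrite emb_1. ring.
Qed.

(** If the bound failed for some radius above 1, the failing radii would have a supremum r0 > 1,
    since [nrm T + 1] is a good radius. Equicontinuity near r0 then carries the bound from radii
    just above r0 to a failing radius just below or equal to r0. *)
Lemma growth_le_all r : 1 < r -> growth_le r.
Proof.
  intros Hr. apply NNPP. intros Hn.
  assert (growth_le (nrm T + 1)) as Htop.
  { exists 1, O. intros N _. rewrite Rmult_1_l. eapply Rle_trans; [apply nrm_pow|].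
    apply pow_incr. pose proof (nrm_ge0 T). lra. }
  assert (forall a b, 0 < a <= b -> growth_le a -> growth_le b) as Hmono.
  { intros a b Hab Ha. destruct (proj2 Hab) as [L| ->]; [|assumption].
    destruct (growth_le_lt a b 1 ltac:(lra) ltac:(lra) Ha) as [N0 H]. now exists 1, N0. }
  pose proof (nrm_ge0 T) as HT.
  destruct (completeness (fun x => 1 < x /\ ~ growth_le x)) as [r0 [Hub Hlub]].
  - exists (nrm T + 1). intros x [Hx Hnx]. apply Rnot_lt_le. intros L. apply Hnx.
    apply Hmono with (nrm T + 1); [lra|assumption].
  - now exists r.
  - assert (1 < r0) as Hr0 by (apply Rlt_le_trans with r; [assumption|apply Hub; now split]).
    destruct (avg_equicontinuous r0 Hr0) as [eta [He [He1 Hav]]].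
    assert (exists q, (1 < q /\ ~ growth_le q) /\ r0 - eta < q) as [q [[Hq Hnq] Hq2]].
    { apply NNPP. intros Hno. assert (r0 <= r0 - eta); [|lra].
      apply Hlub. intros x Hx. apply Rnot_lt_le. intros L. apply Hno. now exists x. }
    assert (q <= r0) by (apply Hub; now split).
    (* Two radii above the supremum are needed: growth at the smaller one makes the scaled powers at
       the larger one tend to zero. *)
    apply Hnq. apply growth_le_step with (r0 + eta / 2) (r0 + eta); try lra.
    + intros N HN. apply Hav; [lra|lra|assumption].
    + apply NNPP. intros Hn1. assert (r0 + eta / 2 <= r0); [|lra].
      apply Hub. split; [lra|assumption].
Qed.

Lemma pow_small r N0 : 1 < r -> exists N, (N0 <= N)%nat /\ nrm (T ^ N) <= r ^ N.
Proof.
  intros Hr.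
  destruct (growth_le_lt ((1 + r) / 2) r 1 ltac:(lra) ltac:(lra) (growth_le_all ((1 + r) / 2) ltac:(lra))) as [N1 H].
  exists (max N0 N1). split; [lia|]. rewrite <- (Rmult_1_l (r ^ _)). apply H. lia.
Qed.

(* Since [avg r N k n * (1 - r^-N T^N) = T^n (1 - T)^k] and [r^-N T^N] has norm at most 1 for suitable large [N]. *)
Lemma nrm_pow_le_avg r k n b N0 : 1 < r ->
  (forall N, (N0 <= N)%nat -> nrm (avg r N k n) <= b) ->
  nrm (T ^ n * (1 - T) ^ k)%A <= 2 * b.
Proof.
  intros Hr H. destruct (pow_small r (max N0 (S (n + k))) Hr) as [N [HN HT]].
  rewrite <- (avg_spec r N k n Hr) by lia.
  rewrite Rmult_comm. apply nrm_mul_le; [apply H; lia|].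
  eapply Rle_trans; [apply nrm_sub|].
  pose proof (@nrm_1 A).
  assert (nrm (emb (RtoC (/ r ^ N)) * T ^ N) <= 1); [|lra].
  apply nrm_scaled_pow; lra.
Qed.

End Rickart.

(** * Differences, summation by parts and sums of powers *)

Section Differences.
Context {A : comm_normed_alg}.
Add Ring calg_ring_inst4 : (calg_ring A).
Local Notation emb := (@emb A).
Implicit Types F G : nat -> A.

Definition fd F (j : nat) : A := (F (S j) - F j)%A.

(** The new difference is applied innermost, so a bound on the differences of order i + 1 of [F] is
    by conversion a bound on those of order i of [fd F]. *)
Fixpoint fdn (i : nat) F : nat -> A :=
  match i with O => F | S p => fdn p (fd F) end.

Lemma fdn_ext i F G : (forall s, F s = G s) -> forall s, fdn i F s = fdn i G s.
Proof.
  revert F G. induction i; intros F G H s; simpl; [apply H|].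
  apply IHi. intros; unfold fd; now rewrite !H.
Qed.

Lemma fdn_add i F G s : (fdn i (fun s => F s + G s) s = fdn i F s + fdn i G s)%A.
Proof.
  revert F G s. induction i; intros F G s; simpl; [reflexivity|].
  rewrite <- IHi. apply fdn_ext. intros; unfold fd; ring.
Qed.

Lemma fdn_shift i F j s : fdn i (fun s => F (j + s)%nat) s = fdn i F (j + s)%nat.
Proof.
  revert F s. induction i; intros F s; simpl; [reflexivity|].
  rewrite <- IHi. apply fdn_ext. intros; unfold fd. now rewrite Nat.add_succ_r.
Qed.

(* The discrete analogue of a symbol class: [w] is the size, and each difference costs a factor [v]. *)
Definition symbol F (w v : R) (m : nat) : Prop :=
  forall i s, (i + s <= m)%nat -> nrm (fdn i F s) <= w * v ^ i.

Lemma symbol_ext F G w v m : (forall s, F s = G s) -> symbol F w v m -> symbol G w v m.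
Proof. intros E H i s Hi. rewrite <- (fdn_ext i F G E). now apply H. Qed.

Lemma symbol_ge0 F w v m : symbol F w v m -> 0 <= w.
Proof.
  intros H. specialize (H O O ltac:(lia)). simpl in H. pose proof (nrm_ge0 (F O)). lra.
Qed.

Lemma symbol_mono F w v w' v' m : w <= w' -> 0 <= v <= v' -> symbol F w v m -> symbol F w' v' m.
Proof.
  intros Hw Hv H i s Hi. pose proof (symbol_ge0 _ _ _ _ H).
  eapply Rle_trans; [now apply H|].
  apply Rmult_le_compat; try assumption; [now apply pow_le|now apply pow_incr].
Qed.

(** Order and shift share the budget [m], so a difference or a shift lowers it by one; this is the
    induction variable in all the symbol estimates. *)
Lemma symbol_fd F w v m : symbol F w v (S m) -> symbol (fd F) (w * v) v m.
Proof. intros H i s Hi. rewrite Rmult_assoc. apply (H (S i)). lia. Qed.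

Lemma symbol_shift F w v m : symbol F w v (S m) -> symbol (fun s => F (S s)) w v m.
Proof. intros H i s Hi. pose proof (fdn_shift i F 1 s) as E. simpl in E. rewrite E. apply H. lia. Qed.

Lemma symbol_pred F w v m : symbol F w v (S m) -> symbol F w v m.
Proof. intros H i s Hi. apply H. lia. Qed.

Lemma symbol_S F w v m :
  (forall s, (s <= S m)%nat -> nrm (F s) <= w) -> symbol (fd F) (w * v) v m -> symbol F w v (S m).
Proof.
  intros H0 H i s Hi. destruct i as [|i]; simpl.
  - rewrite Rmult_1_r. apply H0. lia.
  - rewrite <- Rmult_assoc. apply H. lia.
Qed.

Lemma symbol_add F G w1 w2 v m :
  symbol F w1 v m -> symbol G w2 v m -> symbol (fun s => F s + G s)%A (w1 + w2) v m.
Proof.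
  intros HF HG i s Hi. rewrite fdn_add, Rmult_plus_distr_r.
  eapply Rle_trans; [apply nrm_add|]. apply Rplus_le_compat; auto.
Qed.

(** Discrete Leibniz rule: the difference of F G is (fd F) times the shifted G, plus F times (fd G).
    The two terms double the constant at each level, whence 2^m. *)
Lemma symbol_mul F G w1 w2 v m :
  symbol F w1 v m -> symbol G w2 v m -> symbol (fun s => F s * G s)%A (2 ^ m * (w1 * w2)) v m.
Proof.
  revert F G w1 w2. induction m as [|m IH]; intros F G w1 w2 HF HG;
    pose proof (symbol_ge0 _ _ _ _ HF); pose proof (symbol_ge0 _ _ _ _ HG).
  - intros i s Hi. assert (i = O /\ s = O) as [-> ->] by lia. simpl.
    rewrite Rmult_1_l, Rmult_1_r.
    specialize (HF O O (le_n _)). specialize (HG O O (le_n _)). simpl in HF, HG.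
    apply nrm_mul_le; lra.
  - apply symbol_S.
    + intros s Hs. specialize (HF O s Hs). specialize (HG O s Hs). simpl in HF, HG.
      apply Rle_trans with (w1 * w2); [apply nrm_mul_le; lra|].
      assert (1 <= 2 ^ S m) by (apply pow_R1_Rle; lra). assert (0 <= w1 * w2) by nra. nra.
    + replace (2 ^ S m * (w1 * w2) * v) with (2 ^ m * (w1 * v * w2) + 2 ^ m * (w1 * (w2 * v)))
        by (simpl; ring).
      apply symbol_ext with (fun s => (fd F s * G (S s) + F s * fd G s)%A).
      * intros s. unfold fd. ring.
      * apply symbol_add; apply IH; auto using symbol_fd, symbol_shift, symbol_pred.
Qed.

Lemma fdn_0 i s : fdn i (fun _ => 0%A) s = 0%A.
Proof.
  induction i as [|i IH]; simpl; [reflexivity|].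
  rewrite (fdn_ext i _ (fun _ => 0%A)) by (intros; unfold fd; ring). exact IH.
Qed.

Lemma symbol_one v m : 0 <= v -> symbol (fun _ => 1%A) 1 v m.
Proof.
  intros Hv i s _. destruct i as [|i]; simpl.
  - rewrite Rmult_1_r. apply nrm_1.
  - rewrite (fdn_ext i _ (fun _ => 0%A)) by (intros; unfold fd; ring).
    rewrite fdn_0, nrm_0, Rmult_1_l. apply Rmult_le_pos; [assumption|now apply pow_le].
Qed.

Lemma symbol_pow F w v m k : 0 <= v ->
  symbol F w v m -> symbol (fun s => F s ^ k)%A ((2 ^ m * w) ^ k) v m.
Proof.
  intros Hv H. induction k as [|k IH]; simpl; [now apply symbol_one|].
  rewrite Rmult_assoc. now apply symbol_mul.
Qed.

Lemma symbol_pnt r N j c v m :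
  0 <= r -> Cmod (cis (2 * PI / INR N) - 1) <= v ->
  symbol (fun s => emb (c * pnt r N (j + s))%C) (Cmod c * r) v m.
Proof.
  intros Hr Hv i s _. set (u := cis (2 * PI / INR N)) in *.
  assert (fdn i (fun s => emb (c * pnt r N (j + s))%C) s
    = emb ((u - RtoC 1) ^ i * c * pnt r N (j + s))%C) as E.
  { clear. revert c s. induction i as [|i IH]; intros c s.
    - simpl. f_equal. ring.
    - simpl fdn. rewrite (fdn_ext i _ (fun s => emb ((u - RtoC 1) * c * pnt r N (j + s))%C)).
      + rewrite IH. f_equal. simpl Cpow. ring.
      + intros t. unfold fd. rewrite <- emb_sub. f_equal. rewrite Nat.add_succ_r, pnt_S. fold u. ring. }
  rewrite E. pose proof (Cmod_ge_0 c).
  replace (emb ((u - RtoC 1) ^ i * c * pnt r N (j + s))%C)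
    with (emb ((u - RtoC 1) ^ i * c * pnt r N (j + s))%C * 1)%A by ring.
  eapply Rle_trans; [apply nrm_emb_mul|].
  rewrite !Cmod_mult, Cmod_pow, Cmod_pnt by assumption.
  pose proof (@nrm_1 A). pose proof (nrm_ge0 (@aone A)).
  assert (Cmod (u - 1) ^ i <= v ^ i) by (apply pow_incr; split; [apply Cmod_ge_0|assumption]).
  assert (0 <= Cmod (u - 1) ^ i) by (apply pow_le, Cmod_ge_0).
  assert (0 <= Cmod c * r) by now apply Rmult_le_pos.
  apply Rle_trans with (Cmod (u - 1) ^ i * (Cmod c * r)); [|nra].
  rewrite <- (Rmult_1_r (_ ^ i * (_ * r))), <- Rmult_assoc.
  apply Rmult_le_compat_l; [|assumption]. rewrite Rmult_assoc. now apply Rmult_le_pos.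
Qed.

(** The size of 1 - lambda may be much smaller than that of lambda, while both have differences of
    the same size; the last hypothesis is what allows these differences to be charged as D v. *)
Lemma symbol_one_sub_pnt r N j D v m :
  0 <= r -> (forall s, (s <= m)%nat -> Cmod (1 - pnt r N (j + s)) <= D) ->
  Cmod (cis (2 * PI / INR N) - 1) <= v -> Cmod (cis (2 * PI / INR N) - 1) * r <= D * v ->
  symbol (fun s => emb (RtoC 1 - pnt r N (j + s))%C) D v m.
Proof.
  intros Hr HD Hv HDv. set (u := cis (2 * PI / INR N)) in *.
  assert (forall s, (s <= m)%nat -> nrm (emb (RtoC 1 - pnt r N (j + s))%C) <= D) as H0.
  { intros s Hs. replace (emb (RtoC 1 - pnt r N (j + s))%C) with (emb (RtoC 1 - pnt r N (j + s))%C * 1)%A by ring.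
    rewrite <- (Rmult_1_r D). apply nrm_emb_mul_le; [now apply HD|apply nrm_1]. }
  destruct m as [|m].
  - intros i s Hi. assert (i = O /\ s = O) as [-> ->] by lia. simpl. rewrite Rmult_1_r. now apply H0.
  - apply symbol_S; [assumption|].
    apply symbol_ext with (fun s => emb (- (u - RtoC 1) * pnt r N (j + s))%C).
    + intros s. unfold fd. rewrite <- emb_sub. f_equal. rewrite Nat.add_succ_r, pnt_S. fold u. ring.
    + apply symbol_mono with (Cmod (- (u - 1)) * r) v.
      * rewrite Cmod_opp. assumption.
      * split; [|lra]. apply Rle_trans with (2 := Hv). apply Cmod_ge_0.
      * now apply symbol_pnt.
Qed.

(** * Differences of the resolvent along the sample points, and summation by parts *)

Context (T : A) (Res : Complex.C -> A).
Context (HRes : forall z, 1 < Cmod z -> ((emb z - T) * Res z = 1)%A).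

(** By the resolvent identity, a difference of R is -(u - 1) lambda R(lambda) R(u lambda), where u
    is the rotation by one step: a product of symbols to which the induction and the Leibniz rule
    apply. So a size bound alone controls all differences, with a constant independent of N and
    j. *)
Lemma symbol_res m : exists K, 1 <= K /\ forall r N j w, 1 < r <= 2 -> 1 <= w ->
  (forall s, (s <= m)%nat -> nrm (Res (pnt r N (j + s))) <= w) ->
  symbol (fun s => Res (pnt r N (j + s))) w (K * w * Cmod (cis (2 * PI / INR N) - 1)) m.
Proof.
  induction m as [|m [K [HK IH]]].
  - exists 1. split; [lra|]. intros r N j w Hr Hw H i s Hi.
    assert (i = O /\ s = O) as [-> ->] by lia. simpl. rewrite Rmult_1_r. now apply H.
  (* Each 2^m pays for one use of [symbol_mul]; the middle 2 bounds [r]. *)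
  - pose proof (Rmax_l K (2 ^ m * (2 * 2 ^ m))) as M1. pose proof (Rmax_r K (2 ^ m * (2 * 2 ^ m))) as M2.
    set (K' := Rmax K (2 ^ m * (2 * 2 ^ m))) in *.
    exists K'. split; [lra|]. intros r N j w Hr Hw H.
    set (u := cis (2 * PI / INR N)) in *. pose proof (Cmod_ge_0 (u - 1)) as Hd.
    set (d := Cmod (u - 1)) in *.
    assert (symbol (fun s => Res (pnt r N (j + s))) w (K * w * d) m) as S1
      by (apply IH; [assumption..|]; intros; apply H; lia).
    assert (symbol (fun s => Res (pnt r N (j + S s))) w (K * w * d) m) as S2.
    { eapply symbol_ext; [|apply (IH r N (S j)); [assumption..|]].
      - intros s. simpl. now rewrite Nat.add_succ_r.
      - intros s Hs. replace (S j + s)%nat with (j + S s)%nat by lia. apply H. lia. }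
    assert (0 <= w * d) by (apply Rmult_le_pos; lra).
    apply symbol_S; [assumption|].
    apply symbol_mono with (2 ^ m * (Cmod (- (u - 1)) * r * (2 ^ m * (w * w)))) (K * w * d).
    + rewrite Cmod_opp. fold d.
      assert (0 < 2 ^ m) by (apply pow_lt; lra).
      replace (2 ^ m * (d * r * (2 ^ m * (w * w)))) with (w * (w * d) * (2 ^ m * 2 ^ m * r)) by ring.
      replace (w * (K' * w * d)) with (w * (w * d) * K') by ring.
      apply Rmult_le_compat_l; [nra|]. nra.
    + split; [rewrite Rmult_assoc; apply Rmult_le_pos; lra|]. rewrite !Rmult_assoc.
      apply Rmult_le_compat_r; lra.
    + apply symbol_ext with (fun s => (emb (- (u - RtoC 1) * pnt r N (j + s))%C *
        (Res (pnt r N (j + s)) * Res (pnt r N (j + S s))))%A).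
      * intros s. unfold fd.
        transitivity (- (Res (pnt r N (j + s)) - Res (pnt r N (j + S s))))%A; [|ring].
        rewrite (res_diff T Res HRes) by (rewrite Cmod_pnt; lra).
        replace (- (u - RtoC 1) * pnt r N (j + s))%C with (- (pnt r N (j + S s) - pnt r N (j + s)))%C.
        -- rewrite emb_opp. ring.
        -- rewrite Nat.add_succ_r, pnt_S. fold u. ring.
      * apply symbol_mul; [|now apply symbol_mul].
        apply symbol_pnt; [lra|]. fold u; fold d.
        replace (K * w * d) with (K * (w * d)) by ring. nra.
Qed.

Definition wres (k : nat) (r : R) (N j : nat) : A :=
  (emb (RtoC 1 - pnt r N j)%C ^ k * Res (pnt r N j))%A.

(** The condition 1 <= w D says that differencing 1 - lambda, a relative cost of order |u - 1| / D,
    is no dearer than differencing the resolvent, which costs w |u - 1|. *)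
Lemma symbol_wres k m : exists K, 1 <= K /\ forall r N j w D, 1 < r <= 2 -> 1 <= w -> 1 <= w * D ->
  (forall s, (s <= m)%nat -> nrm (Res (pnt r N (j + s))) <= w) ->
  (forall s, (s <= m)%nat -> Cmod (1 - pnt r N (j + s)) <= D) ->
  symbol (fun s => wres k r N (j + s)) (K * D ^ k * w)
    (K * w * Cmod (cis (2 * PI / INR N) - 1)) m.
Proof.
  destruct (symbol_res m) as [K1 [HK1 H1]].
  set (q := 2 ^ m * (2 ^ m) ^ k).
  assert (0 < q) as Hq by (apply Rmult_lt_0_compat; repeat apply pow_lt; lra).
  exists (2 * K1 + q). split; [lra|].
  intros r N j w D Hr Hw HwD HR HD.
  pose proof (Cmod_ge_0 (cis (2 * PI / INR N) - 1)) as Hd.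
  specialize (H1 r N j w Hr Hw HR).
  set (d := Cmod (cis (2 * PI / INR N) - 1)) in *.
  assert (0 <= D).
  { eapply Rle_trans; [apply Cmod_ge_0|apply (HD O); lia]. }
  assert (0 <= w * d) by (apply Rmult_le_pos; lra).
  assert (0 <= D ^ k) by now apply pow_le.
  apply symbol_mono with (2 ^ m * ((2 ^ m * D) ^ k * w)) (2 * K1 * w * d).
  - replace (2 ^ m * ((2 ^ m * D) ^ k * w)) with (q * (D ^ k * w))
      by (unfold q; rewrite Rpow_mult_distr; ring).
    rewrite Rmult_assoc. apply Rmult_le_compat_r; [|lra]. apply Rmult_le_pos; lra.
  - split.
    + replace (2 * K1 * w * d) with (2 * K1 * (w * d)) by ring. apply Rmult_le_pos; lra.
    + rewrite !(Rmult_assoc _ w d). apply Rmult_le_compat_r; lra.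
  - assert (0 <= 2 * K1 * w * d) as Hv by (rewrite (Rmult_assoc _ w d); apply Rmult_le_pos; lra).
    assert (w * d <= K1 * (w * d)) by nra.
    apply symbol_mul.
    + apply (symbol_pow (fun s => emb (RtoC 1 - pnt r N (j + s))%C)); [assumption|].
      apply symbol_one_sub_pnt; [lra|assumption| |]; fold d.
      * apply Rle_trans with (1 * d); [lra|].
        apply Rle_trans with (w * d); [apply Rmult_le_compat_r; lra|]. lra.
      * replace (D * (2 * K1 * w * d)) with (2 * K1 * (w * D) * d) by ring.
        rewrite (Rmult_comm d). apply Rmult_le_compat_r; [assumption|]. nra.
    + eapply symbol_mono; [apply Rle_refl| |apply H1]. split.
      * rewrite (Rmult_assoc _ w d). apply Rmult_le_pos; lra.
      * rewrite !(Rmult_assoc _ w d). apply Rmult_le_compat_r; lra.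
Qed.

(** Telescoping of z^j F(j): its difference is (z - 1) z^j F(j) + z^(j+1) (fd F)(j). *)
Lemma abel_sum z F a l :
  ((emb z - 1) * asum (fun j => emb (z ^ (a + j))%C * F (a + j)%nat) l
   = emb (z ^ (a + l))%C * F (a + l)%nat - emb (z ^ a)%C * F a
     - emb z * asum (fun j => emb (z ^ (a + j))%C * fd F (a + j)%nat) l)%A.
Proof.
  induction l as [|l IH]; simpl.
  - rewrite Nat.add_0_r. ring.
  - transitivity ((emb z - 1) * asum (fun j => emb (z ^ (a + j))%C * F (a + j)%nat) l
      + (emb z - 1) * (emb (z ^ (a + l))%C * F (a + l)%nat))%A; [ring|].
    rewrite IH, Nat.add_succ_r, Cpow_S, emb_mul. unfold fd. ring.
Qed.

Lemma abel_norm z F a l zeta : Cmod z = 1 -> 0 < zeta -> 1 <= zeta * Cmod (z - 1) ->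
  nrm (asum (fun j => emb (z ^ (a + j))%C * F (a + j)%nat)%A l)
  <= zeta * (nrm (F (a + l)%nat) + nrm (F a)
      + nrm (asum (fun j => emb (z ^ (a + j))%C * fd F (a + j)%nat)%A l)).
Proof.
  intros Hz Hzeta H. pose proof (abel_sum z F a l) as E.
  set (S1 := asum _ _) in *. set (S2 := asum (fun j => _ * fd F _)%A _) in *.
  assert (0 < Cmod (z - 1)) as H0.
  { destruct (Rle_lt_or_eq_dec _ _ (Cmod_ge_0 (z - 1))) as [|E0]; [assumption|].
    rewrite <- E0 in H. lra. }
  assert (z - 1 <> 0)%C as Hne by now apply Cmod_gt_0.
  replace S1 with (emb (/ (z - RtoC 1))%C * ((emb z - 1) * S1))%A.
  2:{ transitivity (emb (/ (z - RtoC 1))%C * (emb z - emb (RtoC 1)) * S1)%A; [rewrite emb_1; ring|].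
      rewrite <- emb_sub, <- emb_mul, Cinv_l by assumption. rewrite emb_1. ring. }
  rewrite E. apply nrm_emb_mul_le.
  - rewrite Cmod_inv by assumption. apply Rmult_le_reg_r with (Cmod (z - 1)); [assumption|].
    rewrite Rinv_l by lra. assumption.
  - assert (forall i x, nrm (emb (z ^ i)%C * x) <= nrm x) as U.
    { intros i x. eapply Rle_trans; [apply nrm_emb_mul|]. rewrite Cmod_pow, Hz, pow1. lra. }
    eapply Rle_trans; [apply nrm_sub|]. apply Rplus_le_compat.
    + eapply Rle_trans; [apply nrm_sub|]. apply Rplus_le_compat; apply U.
    + rewrite <- (Cpow_1_r z) at 1. apply U.
Qed.

(** Weighting order i by zeta^i makes the statement homogeneous: passing from F to [fd F] divides B
    and Q by zeta, which the factor zeta of [abel_norm] restores. Each step adds two boundary terms,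
    hence 2 m zeta B. *)
Lemma abel_iter z a l zeta : Cmod z = 1 -> 0 < zeta -> 1 <= zeta * Cmod (z - 1) ->
  forall m F B Q,
  (forall i, (i < m)%nat -> zeta ^ i * nrm (fdn i F a) <= B) ->
  (forall i, (i < m)%nat -> zeta ^ i * nrm (fdn i F (a + l)%nat) <= B) ->
  rsum (fun j => zeta ^ m * nrm (fdn m F (a + j)%nat)) l <= Q ->
  nrm (asum (fun j => emb (z ^ (a + j))%C * F (a + j)%nat)%A l) <= 2 * INR m * zeta * B + Q.
Proof.
  intros Hz Hzeta H m. induction m as [|m IH]; intros F B Q Ha Hb HQ.
  - eapply Rle_trans; [apply nrm_asum|]. simpl INR.
    replace (2 * 0 * zeta * B + Q) with Q by ring.
    eapply Rle_trans; [|apply HQ]. apply rsum_le. intros j _.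
    eapply Rle_trans; [apply nrm_emb_mul|]. rewrite Cmod_pow, Hz, pow1. simpl. lra.
  - eapply Rle_trans; [now apply (abel_norm z F a l zeta)|].
    pose proof (Ha O ltac:(lia)) as Ha0. pose proof (Hb O ltac:(lia)) as Hb0. simpl in Ha0, Hb0.
    assert (forall i x y, zeta ^ S i * x <= y -> zeta ^ i * x <= y / zeta) as Hdiv.
    { intros i x y Hxy. apply Rmult_le_reg_l with zeta; [assumption|].
      replace (zeta * (y / zeta)) with y by (field; lra). rewrite <- Rmult_assoc. exact Hxy. }
    assert (nrm (asum (fun j => emb (z ^ (a + j))%C * fd F (a + j)%nat)%A l)
      <= 2 * INR m * zeta * (B / zeta) + Q / zeta) as G.
    { apply IH.
      - intros i Hi. apply Hdiv, (Ha (S i)). lia.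
      - intros i Hi. apply Hdiv, (Hb (S i)). lia.
      - rewrite rsum_scal. apply Hdiv. rewrite <- rsum_scal. exact HQ. }
    rewrite S_INR.
    apply Rle_trans with (zeta * (B + B + (2 * INR m * zeta * (B / zeta) + Q / zeta))).
    + apply Rmult_le_compat_l; lra.
    + right. field. lra.
Qed.

End Differences.

(** * Real powers and their sums *)

Lemma Rpower_gt0 x y : 0 < Rpower x y.
Proof. apply exp_pos. Qed.

Lemma Rpower_antitone x y e : e <= 0 -> 0 < x <= y -> Rpower y e <= Rpower x e.
Proof.
  intros He Hx. replace e with (- (- e)) by ring. rewrite !(Rpower_Ropp _ (- e)).
  apply Rinv_le_contravar; [apply Rpower_gt0|]. apply Rle_Rpower_l; lra.
Qed.

(** The mean value theorem turns the comparison of a power sum with an integral into a telescoping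
    induction. *)
Lemma Rpower_diff x e : 0 < x ->
  exists c, x <= c <= x + 1 /\ Rpower (x + 1) e - Rpower x e = e * Rpower c (e - 1).
Proof.
  intros Hx.
  destruct (MVT_gen (fun t => Rpower t e) x (x + 1) (fun t => e * Rpower t (e - 1))) as [c [Hc E]].
  - rewrite Rmin_left, Rmax_right by lra. intros t Ht.
    apply is_derive_Reals, derivable_pt_lim_power. lra.
  - rewrite Rmin_left, Rmax_right by lra. intros t Ht.
    apply derivable_continuous_pt. exists (e * Rpower t (e - 1)). apply derivable_pt_lim_power. lra.
  - rewrite Rmin_left, Rmax_right in Hc by lra. exists c. split; [assumption|]. rewrite E. ring.
Qed.

Lemma rsum_power_small g J : -1 < g <= 0 -> (1 <= J)%nat ->
  rsum (fun j => Rpower (INR j + 1) g) J <= Rpower (INR J) (g + 1) / (g + 1).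
Proof.
  intros Hg HJ. induction J as [|J IH]; [lia|].
  destruct J as [|J].
  - simpl. rewrite !Rplus_0_l. unfold Rpower. rewrite ln_1, !Rmult_0_r, exp_0.
    apply Rmult_le_reg_r with (g + 1); [lra|]. unfold Rdiv; rewrite Rmult_assoc, Rinv_l; lra.
  - specialize (IH ltac:(lia)). cbn [rsum] in *. rewrite (S_INR (S J)).
    assert (0 < INR (S J)) by (apply lt_0_INR; lia). set (x := INR (S J)) in *.
    destruct (Rpower_diff x (g + 1)) as [c [Hc E]]; [assumption|].
    replace (g + 1 - 1) with g in E by ring.
    assert (Rpower (x + 1) g <= Rpower c g) by (apply Rpower_antitone; lra).
    replace (Rpower (x + 1) (g + 1)) with (Rpower x (g + 1) + (g + 1) * Rpower c g) by lra.
    replace ((Rpower x (g + 1) + (g + 1) * Rpower c g) / (g + 1))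
      with (Rpower x (g + 1) / (g + 1) + Rpower c g) by (field; lra).
    lra.
Qed.

Lemma rsum_power_tail p J L : 1 < p -> (1 <= J)%nat ->
  rsum (fun i => Rpower (INR (J + i) + 1) (- p)) L <= Rpower (INR J) (1 - p) / (p - 1).
Proof.
  intros Hp HJ.
  apply Rle_trans with ((Rpower (INR J) (1 - p) - Rpower (INR (J + L)) (1 - p)) / (p - 1)).
  - induction L as [|L IH].
    + simpl. rewrite Nat.add_0_r. unfold Rdiv. rewrite Rminus_diag. lra.
    + cbn [rsum]. rewrite Nat.add_succ_r, S_INR.
      assert (0 < INR (J + L)) by (apply lt_0_INR; lia). set (x := INR (J + L)) in *.
      destruct (Rpower_diff x (1 - p)) as [c [Hc E]]; [assumption|].
      replace (1 - p - 1) with (- p) in E by ring.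
      assert (Rpower (x + 1) (- p) <= Rpower c (- p)) by (apply Rpower_antitone; lra).
      replace (Rpower (x + 1) (1 - p)) with (Rpower x (1 - p) + (1 - p) * Rpower c (- p)) by lra.
      replace ((Rpower (INR J) (1 - p) - (Rpower x (1 - p) + (1 - p) * Rpower c (- p))) / (p - 1))
        with ((Rpower (INR J) (1 - p) - Rpower x (1 - p)) / (p - 1) + Rpower c (- p)) by (field; lra).
      lra.
  - apply Rmult_le_compat_r; [apply Rlt_le, Rinv_0_lt_compat; lra|].
    pose proof (Rpower_gt0 (INR (J + L)) (1 - p)). lra.
Qed.

(** * The estimate in a commutative normed algebra *)

(** For g >= 0 the upper bound on d and the number of terms suffice. For g < 0 the lower bound on d
    is used instead, and g > -1 makes the singular power summable at 0. *)
Lemma rsum_power_near g : -1 < g -> exists C, 0 < C /\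
  forall (d : nat -> R) x N J, 0 < x -> 0 < N -> (1 <= J)%nat -> INR J <= N * x ->
  (forall j, (j < J)%nat -> (INR j + 1) / (2 * N) <= d j <= 3 * x) ->
  rsum (fun j => Rpower (d j) g) J <= C * (N * Rpower x (g + 1)).
Proof.
  intros Hg. destruct (Rle_dec 0 g) as [H0|H0].
  - exists (Rpower 3 g). split; [apply Rpower_gt0|]. intros d x N J Hx HN HJ HJx Hd.
    apply Rle_trans with (rsum (fun _ => Rpower (3 * x) g) J).
    + apply rsum_le. intros j Hj. apply Rle_Rpower_l; [assumption|]. destruct (Hd j Hj).
      split; [|assumption]. eapply Rlt_le_trans; [|eassumption].
      apply Rdiv_lt_0_compat; [|lra]. pose proof (pos_INR j). lra.
    + rewrite rsum_const, <- Rpower_mult_distr, Rpower_plus, Rpower_1 by lra.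
      pose proof (Rpower_gt0 3 g). pose proof (Rpower_gt0 x g).
      replace (Rpower 3 g * (N * (Rpower x g * x))) with (N * x * (Rpower 3 g * Rpower x g)) by ring.
      apply Rmult_le_compat_r; [nra|assumption].
  - exists (Rpower 2 (- g) / (g + 1)).
    split; [apply Rdiv_lt_0_compat; [apply Rpower_gt0|lra]|].
    intros d x N J Hx HN HJ HJx Hd.
    apply Rle_trans with (rsum (fun j => Rpower (2 * N) (- g) * Rpower (INR j + 1) g) J).
    + apply rsum_le. intros j Hj. destruct (Hd j Hj) as [D1 D2]. pose proof (pos_INR j).
      replace (Rpower (2 * N) (- g) * Rpower (INR j + 1) g) with (Rpower ((INR j + 1) / (2 * N)) g).
      * apply Rpower_antitone; [lra|]. split; [apply Rdiv_lt_0_compat; lra|assumption].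
      * unfold Rdiv. rewrite <- Rpower_mult_distr by (try apply Rinv_0_lt_compat; lra).
        rewrite Rmult_comm. f_equal. unfold Rpower. rewrite ln_Rinv by lra. f_equal; ring.
    + rewrite rsum_scal.
      apply Rle_trans with (Rpower (2 * N) (- g) * (Rpower (N * x) (g + 1) / (g + 1))).
      * apply Rmult_le_compat_l; [apply Rlt_le, Rpower_gt0|].
        eapply Rle_trans; [apply rsum_power_small; [lra|assumption]|].
        apply Rmult_le_compat_r; [apply Rlt_le, Rinv_0_lt_compat; lra|].
        apply Rle_Rpower_l; [lra|]. split; [apply lt_0_INR; lia|assumption].
      * rewrite <- !Rpower_mult_distr by lra.
        assert (Rpower N (- g) * Rpower N (g + 1) = N) as E.
        { rewrite <- Rpower_plus. replace (- g + (g + 1)) with 1 by ring. now apply Rpower_1. }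
        right. rewrite <- E at 3. field. lra.
Qed.

Lemma rsum_power_far p : 1 < p -> exists C, 0 < C /\
  forall (d : nat -> R) x N J L, 0 < x -> (1 <= J)%nat -> (N = J + L + J)%nat ->
  INR N * x / 8 <= INR J ->
  (forall j, (J <= j < J + L)%nat -> INR (Nat.min (j + 1) (N - j)) / (2 * INR N) <= d j) ->
  rsum (fun i => Rpower (d (J + i)%nat) (- p)) L <= C * (INR N * Rpower x (1 - p)).
Proof.
  intros Hp. exists (2 * Rpower 2 p * Rpower 8 (p - 1) / (p - 1)). split.
  { apply Rdiv_lt_0_compat; [|lra]. pose proof (Rpower_gt0 2 p). pose proof (Rpower_gt0 8 (p - 1)). nra. }
  intros d x N J L Hx HJ HN HJx Hd.
  assert (0 < INR N) as HN0 by (apply lt_0_INR; lia).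
  set (f := fun i => Rpower (INR (J + i) + 1) (- p)).
  (* The arc approaches 1 at both of its ends. The power of the minimum is at most the sum of the
     two one-sided powers, and reversal gives these the same sum. *)
  apply Rle_trans with (rsum (fun i => Rpower (2 * INR N) p * (f i + f (L - 1 - i)%nat)) L).
  - apply rsum_le. intros i Hi.
    assert (forall q, (0 < q)%nat -> Rpower (INR q / (2 * INR N)) (- p)
      = Rpower (2 * INR N) p * Rpower (INR q) (- p)) as Eq.
    { intros q Hq. assert (0 < INR q) by (apply lt_0_INR; lia).
      unfold Rdiv. rewrite <- Rpower_mult_distr by (try apply Rinv_0_lt_compat; lra).
      rewrite Rmult_comm. f_equal. unfold Rpower. rewrite ln_Rinv by lra. f_equal; ring. }
    eapply Rle_trans; [apply Rpower_antitone with (x := INR (Nat.min (J + i + 1) (N - (J + i))) / (2 * INR N))|].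
    + lra.
    + split; [|apply Hd; lia]. apply Rdiv_lt_0_compat; [apply lt_0_INR; lia|lra].
    + rewrite Eq by lia. apply Rmult_le_compat_l; [apply Rlt_le, Rpower_gt0|].
      unfold f.
      pose proof (Rpower_gt0 (INR (J + i) + 1) (- p)).
      pose proof (Rpower_gt0 (INR (J + (L - 1 - i)) + 1) (- p)).
      destruct (Nat.min_spec (J + i + 1) (N - (J + i))) as [[_ ->]|[_ ->]].
      * rewrite (plus_INR (J + i) 1). simpl (INR 1). lra.
      * replace (N - (J + i))%nat with (S (J + (L - 1 - i))) by lia. rewrite S_INR. lra.
  - rewrite rsum_scal, rsum_plus, (rsum_rev f L).
    assert (0 < INR J) by (apply lt_0_INR; lia).
    assert (rsum f L <= Rpower (INR N * x / 8) (1 - p) / (p - 1)) as B.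
    { eapply Rle_trans; [apply rsum_power_tail; assumption|].
      apply Rmult_le_compat_r; [apply Rlt_le, Rinv_0_lt_compat; lra|].
      apply Rpower_antitone; [lra|]. split; [|assumption].
      apply Rdiv_lt_0_compat; [nra|lra]. }
    apply Rle_trans with (Rpower (2 * INR N) p * (2 * (Rpower (INR N * x / 8) (1 - p) / (p - 1)))).
    { apply Rmult_le_compat_l; [apply Rlt_le, Rpower_gt0|lra]. }
    unfold Rdiv at 2. assert (0 < / 8) by lra.
    rewrite <- !Rpower_mult_distr by nra.
    assert (Rpower (/ 8) (1 - p) = Rpower 8 (p - 1)) as ->.
    { unfold Rpower. rewrite ln_Rinv by lra. f_equal; ring. }
    assert (Rpower (INR N) p * Rpower (INR N) (1 - p) = INR N) as E.
    { rewrite <- Rpower_plus. replace (p + (1 - p)) with 1 by ring. now apply Rpower_1. }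
    right. rewrite <- E at 3. field. lra.
Qed.

(** * Distances of the sample points from 1 *)

Definition dist1 (r : R) (N j : nat) : R := Cmod (pnt r N j - 1).

Lemma dist1_lower_r r N j : 0 <= r -> r - 1 <= dist1 r N j.
Proof.
  intros Hr. pose proof (Cmod_triangle (pnt r N j - 1) 1) as H.
  replace (pnt r N j - 1 + 1)%C with (pnt r N j) in H by ring.
  rewrite Cmod_pnt, Cmod_1 in H by assumption. unfold dist1. lra.
Qed.

Lemma dist1_lower r N j : 1 <= r -> (0 < N)%nat -> (j <= N)%nat ->
  INR (Nat.min j (N - j)) / INR N <= dist1 r N j.
Proof.
  intros Hr HN Hj. pose proof (cis_root_far N j HN Hj) as H.
  pose proof (dist1_lower_r r N j ltac:(lra)) as H1.
  set (c := cis (2 * PI * INR j / INR N)) in *.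
  assert (Cmod (c - 1) <= dist1 r N j + (r - 1)) as H2.
  { replace (c - 1)%C with ((pnt r N j - 1) + - (RtoC (r - 1) * c))%C
      by (unfold pnt; fold c; rewrite RtoC_minus; ring).
    eapply Rle_trans; [apply Cmod_triangle|]. apply Rplus_le_compat; [apply Rle_refl|].
    rewrite Cmod_opp, Cmod_mult, Cmod_R. unfold c. rewrite Cmod_cis, Rabs_right; lra. }
  assert (2 * INR (Nat.min j (N - j)) / INR N = 2 * (INR (Nat.min j (N - j)) / INR N)) by (unfold Rdiv; ring).
  lra.
Qed.

Lemma dist1_upper r N j : 1 <= r -> (0 < N)%nat -> (j <= N)%nat ->
  dist1 r N j <= r - 1 + 8 * INR (Nat.min j (N - j)) / INR N.
Proof.
  intros Hr HN Hj. pose proof (cis_root_near N j HN Hj) as H.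
  set (c := cis (2 * PI * INR j / INR N)) in *.
  unfold dist1. replace (pnt r N j - 1)%C with (RtoC (r - 1) * c + (c - 1))%C
      by (unfold pnt; fold c; rewrite RtoC_minus; ring).
  eapply Rle_trans; [apply Cmod_triangle|]. apply Rplus_le_compat; [|assumption].
  rewrite Cmod_mult, Cmod_R. unfold c. rewrite Cmod_cis, Rabs_right; lra.
Qed.

(** Half the angular bound plus half the radial bound r - 1. The shift to j + 1 keeps the lower
    bound positive at j = 0 and makes the two ends of the index range symmetric. *)
Lemma dist1_lower_S r N j : 1 <= r -> (j < N)%nat -> / INR N <= r - 1 ->
  INR (Nat.min (j + 1) (N - j)) / (2 * INR N) <= dist1 r N j.
Proof.
  intros Hr Hj Hr1. assert (0 < INR N) by (apply lt_0_INR; lia).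
  pose proof (dist1_lower r N j Hr ltac:(lia) ltac:(lia)).
  pose proof (dist1_lower_r r N j ltac:(lra)).
  assert (INR (Nat.min (j + 1) (N - j)) <= INR (Nat.min j (N - j)) + 1).
  { rewrite <- S_INR. apply le_INR. lia. }
  apply Rle_trans with ((INR (Nat.min j (N - j)) / INR N + / INR N) / 2); [|lra].
  replace ((INR (Nat.min j (N - j)) / INR N + / INR N) / 2)
    with ((INR (Nat.min j (N - j)) + 1) / (2 * INR N)) by (field; lra).
  apply Rmult_le_compat_r; [|assumption]. apply Rlt_le, Rinv_0_lt_compat. lra.
Qed.

Lemma dist1_shift r N j i : 0 <= r <= 2 -> (0 < N)%nat ->
  Rabs (dist1 r N (j + i) - dist1 r N j) <= INR i * (16 / INR N).
Proof.
  intros Hr HN. assert (0 < INR N) by (apply lt_0_INR; lia).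
  induction i as [|i IH].
  - rewrite Nat.add_0_r, Rminus_diag, Rabs_R0. simpl. lra.
  - rewrite Nat.add_succ_r, S_INR.
    assert (Rabs (dist1 r N (S (j + i)) - dist1 r N (j + i)) <= 16 / INR N) as H1.
    { assert (Cmod (pnt r N (S (j + i)) - pnt r N (j + i)) <= 16 / INR N) as H1.
      { rewrite pnt_S.
        replace (cis (2 * PI / INR N) * pnt r N (j + i) - pnt r N (j + i))%C
          with ((cis (2 * PI / INR N) - 1) * pnt r N (j + i))%C by ring.
        rewrite Cmod_mult, Cmod_pnt by lra.
        assert (Cmod (cis (2 * PI / INR N) - 1) <= 8 / INR N) as H2.
        { eapply Rle_trans; [apply Cmod_cis_sub_1_le|]. pose proof PI_4. pose proof PI_RGT_0.
          assert (0 < / INR N) by (apply Rinv_0_lt_compat; lra).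
          unfold Rdiv. rewrite Rabs_right by nra. nra. }
        pose proof (Cmod_ge_0 (cis (2 * PI / INR N) - 1)).
        replace (16 / INR N) with (8 / INR N * 2) by (unfold Rdiv; ring).
        apply Rmult_le_compat; lra. }
      unfold dist1. set (y := pnt r N (S (j + i))) in *. set (z := pnt r N (j + i)) in *.
      pose proof (Cmod_triangle (y - z) (z - 1)) as T1.
      pose proof (Cmod_triangle (- (y - z)) (y - 1)) as T2. rewrite Cmod_opp in T2.
      replace (y - z + (z - 1))%C with (y - 1)%C in T1 by ring.
      replace (- (y - z) + (y - 1))%C with (z - 1)%C in T2 by ring.
      apply Rabs_le. lra. }
    replace (dist1 r N (S (j + i)) - dist1 r N j) with
      ((dist1 r N (S (j + i)) - dist1 r N (j + i)) + (dist1 r N (j + i) - dist1 r N j)) by ring.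
    eapply Rle_trans; [apply Rabs_triang|]. lra.
Qed.

Lemma pow_near_1_le_3 n : (1 <= n)%nat -> (1 + / (2 * INR n)) ^ (n + 1) <= 3.
Proof.
  intros Hn. assert (1 <= INR n) by (change 1 with (INR 1); apply le_INR; lia).
  assert (0 < / (2 * INR n)) by (apply Rinv_0_lt_compat; lra).
  apply Rle_trans with (exp (/ (2 * INR n)) ^ (n + 1)).
  - apply pow_incr. split; [lra|]. apply exp_ineq1_le.
  - rewrite <- Rpower_pow by apply exp_pos. unfold Rpower. rewrite ln_exp.
    apply Rle_trans with (exp 1); [|apply exp_le_3].
    assert (INR (n + 1) * / (2 * INR n) <= 1) as [L| ->]; [|left; now apply exp_increasing|apply Rle_refl].
    rewrite plus_INR. simpl (INR 1).
    apply Rmult_le_reg_r with (2 * INR n); [lra|]. rewrite Rmult_assoc, Rinv_l; lra.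
Qed.

(** * Resolvent bounds near the point 1 and the estimate of the average *)

Section Estimate.
Context {A : comm_normed_alg}.
Add Ring calg_ring_inst5 : (calg_ring A).
Local Notation emb := (@emb A).
Context (T : A) (Res : Complex.C -> A).
Context (HRes : forall z, 1 < Cmod z -> ((emb z - T) * Res z = 1)%A).
Context (alpha beta M : R).
Context (halpha : 0 < alpha) (hbeta0 : 0 <= beta) (hbeta1 : beta < 1) (hab : 1 < alpha + beta).
Context (HM : 0 < M).
Context (HRK : forall z, 1 < Cmod z < 2 ->
  nrm (Res z) <= M / (Rpower (Cmod (z - 1)) alpha * Rpower (Cmod z - 1) beta)).

Let s := alpha / (1 - beta).

Lemma one_lt_s : 1 < s.
Proof.
  unfold s. apply Rmult_lt_reg_r with (1 - beta); [lra|].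
  unfold Rdiv. rewrite Rmult_assoc, Rinv_l; lra.
Qed.

Lemma s_mul : s * (1 - beta) = alpha.
Proof. unfold s. field. lra. Qed.

Lemma res_le z d t : 1 < Cmod z < 2 -> 0 < d <= Cmod (z - 1) -> 0 < t <= Cmod z - 1 ->
  nrm (Res z) <= M * Rpower d (- alpha) * Rpower t (- beta).
Proof.
  intros Hz Hd Ht. eapply Rle_trans; [now apply HRK|].
  unfold Rdiv. rewrite Rmult_assoc. apply Rmult_le_compat_l; [lra|].
  rewrite Rinv_mult, <- !Rpower_Ropp.
  apply Rmult_le_compat; try (apply Rlt_le, Rpower_gt0); apply Rpower_antitone; lra.
Qed.

(* For [|z|] very close to 1, compare with the resolvent at the point [y] on the same ray with
   [|y| = 1 + c |z - 1|^s]: there the hypothesis gives [|y - z| |R(y)| <= 1/2]. *)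
Lemma res_le_dist : exists C, Rpower (5 / 2) s <= C /\
  forall z, 1 < Cmod z <= 3 / 2 -> nrm (Res z) <= C * Rpower (Cmod (z - 1)) (- s).
Proof.
  pose proof one_lt_s as Hs. pose proof s_mul as Hsm.
  (* With d = |z - 1| <= 5/2, [a0] forces t = c d^s below 1/2 and d/2, so that |y| < 2 and |y - 1|
     >= d/2; [b0] forces M 2^alpha c^(1-beta) <= 1/2, the smallness required by [res_near]. *)
  set (a0 := / 2 * Rpower (5 / 2) (- s)).
  set (b0 := Rpower (/ (2 * M * Rpower 2 alpha)) (/ (1 - beta))).
  set (c := Rmin a0 b0).
  pose proof (Rpower_gt0 (5 / 2) (- s)) as P0. pose proof (Rpower_gt0 2 alpha) as P1.
  assert (0 < c) as Hc by (apply Rmin_pos; [unfold a0; lra|apply Rpower_gt0]).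
  assert (c <= a0) as Hca by apply Rmin_l.
  assert (Rpower c (1 - beta) <= / (2 * M * Rpower 2 alpha)) as Hcb.
  { apply Rle_trans with (Rpower b0 (1 - beta)).
    - apply Rle_Rpower_l; [lra|]. split; [assumption|apply Rmin_r].
    - unfold b0. rewrite Rpower_mult, Rinv_l, Rpower_1; try lra.
      apply Rinv_0_lt_compat. apply Rmult_lt_0_compat; lra. }
  pose proof (Rpower_gt0 c (- beta)) as P2. pose proof (Rpower_gt0 (5 / 2) s) as P3.
  assert (0 < M * Rpower 2 alpha * Rpower c (- beta)) as P4 by (repeat apply Rmult_lt_0_compat; lra).
  (* The first summand is the estimate itself; the second makes C d^-s at least 1, because the
     symbol lemmas ask for a size of at least 1. *)
  exists (2 * (M * Rpower 2 alpha * Rpower c (- beta)) + Rpower (5 / 2) s).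
  split; [lra|]. intros z Hz.
  set (d := Cmod (z - 1)).
  assert (0 < d <= 5 / 2) as Hd.
  { pose proof (Cmod_triangle (z - 1) 1) as T1. pose proof (Cmod_triangle z (- (1))) as T2.
    replace (z - 1 + 1)%C with z in T1 by ring. rewrite Cmod_1 in T1. rewrite Cmod_m1 in T2.
    unfold d. unfold Cminus in *. lra. }
  set (t := c * Rpower d s).
  pose proof (Rpower_gt0 d s) as P5. pose proof (Rpower_gt0 d (- s)) as P6.
  assert (0 < t) as Ht by (apply Rmult_lt_0_compat; lra).
  assert (Rpower (5 / 2) (- s) * Rpower (5 / 2) s = 1) as E1.
  { rewrite <- Rpower_plus, Rplus_opp_l, Rpower_O; lra. }
  assert (t <= / 2) as Ht1.
  { assert (Rpower d s <= Rpower (5 / 2) s) by (apply Rle_Rpower_l; lra).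
    apply Rle_trans with (a0 * Rpower (5 / 2) s); [apply Rmult_le_compat; lra|].
    unfold a0. rewrite Rmult_assoc, E1. lra. }
  assert (t <= d / 2) as Ht2.
  { assert (Rpower d s <= d * Rpower (5 / 2) s) as Q.
    { replace s with (1 + (s - 1)) at 1 by ring. rewrite Rpower_plus, Rpower_1 by lra.
      apply Rmult_le_compat_l; [lra|].
      apply Rle_trans with (Rpower (5 / 2) (s - 1)); [apply Rle_Rpower_l; lra|apply Rle_Rpower; lra]. }
    apply Rle_trans with (a0 * (d * Rpower (5 / 2) s)); [apply Rmult_le_compat; lra|].
    unfold a0. replace (/ 2 * Rpower (5 / 2) (- s) * (d * Rpower (5 / 2) s))
      with (d * / 2 * (Rpower (5 / 2) (- s) * Rpower (5 / 2) s)) by ring. rewrite E1. lra. }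
  assert (forall e, Rpower t e = Rpower c e * Rpower d (s * e)) as Et.
  { intros e. unfold t. rewrite <- Rpower_mult_distr, Rpower_mult by lra. reflexivity. }
  assert (Rpower (d / 2) (- alpha) = Rpower 2 alpha * Rpower d (- alpha)) as Eh.
  { unfold Rdiv. rewrite <- Rpower_mult_distr by lra. rewrite Rmult_comm. f_equal.
    unfold Rpower. rewrite ln_Rinv by lra. f_equal. ring. }
  assert (Rpower d (- alpha) * Rpower d (s * - beta) = Rpower d (- s)) as Ed.
  { rewrite <- Rpower_plus. f_equal. rewrite <- Hsm. ring. }
  assert (0 <= Rpower (5 / 2) s * Rpower d (- s)) as P7 by (apply Rmult_le_pos; lra).
  set (b := M * Rpower (d / 2) (- alpha) * Rpower t (- beta)).
  assert (b = M * Rpower 2 alpha * Rpower c (- beta) * Rpower d (- s)) as Eb.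
  { unfold b. rewrite Eh, Et, <- Ed. ring. }
  assert (nrm (Res z) <= 2 * b); [|rewrite Eb in *; lra].
  destruct (Rle_dec (Cmod z - 1) t) as [L|L].
  - set (y := (RtoC ((1 + t) / Cmod z) * z)%C).
    assert (0 < (1 + t) / Cmod z) as Hq by (apply Rdiv_lt_0_compat; lra).
    assert (Cmod y = 1 + t) as Hy.
    { unfold y. rewrite Cmod_mult, Cmod_R, Rabs_right by lra. field. lra. }
    assert (Cmod (z - y) <= t) as Hzy.
    { replace (z - y)%C with (RtoC (1 - (1 + t) / Cmod z) * z)%C
        by (unfold y; rewrite RtoC_minus; ring).
      rewrite Cmod_mult, Cmod_R.
      replace (1 - (1 + t) / Cmod z) with (- ((1 + t - Cmod z) / Cmod z)) by (field; lra).
      rewrite Rabs_Ropp, Rabs_right.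
      - replace ((1 + t - Cmod z) / Cmod z * Cmod z) with (1 + t - Cmod z) by (field; lra). lra.
      - apply Rle_ge, Rmult_le_pos; [lra|apply Rlt_le, Rinv_0_lt_compat; lra]. }
    assert (d / 2 <= Cmod (y - 1)) as Hy1.
    { pose proof (Cmod_triangle (z - y) (y - 1)) as T1.
      replace (z - y + (y - 1))%C with (z - 1)%C in T1 by ring. fold d in T1. lra. }
    assert (nrm (Res y) <= b) as Hb by (apply res_le; lra).
    apply (res_near T Res HRes) with y; try lra.
    apply Rle_trans with (t * b).
    { apply Rmult_le_compat_r; [|assumption]. rewrite Eb. apply Rmult_le_pos; lra. }
    (* All powers of d cancel since s (1 - beta) = alpha; this is what singles out the exponent
       s. *)
    replace (t * b) with (M * Rpower 2 alpha * Rpower c (1 - beta)).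
    + apply Rle_trans with (M * Rpower 2 alpha * / (2 * M * Rpower 2 alpha)).
      * apply Rmult_le_compat_l; [apply Rmult_le_pos; lra|assumption].
      * right. field. lra.
    + unfold b. replace (t * (M * Rpower (d / 2) (- alpha) * Rpower t (- beta)))
        with (M * Rpower (d / 2) (- alpha) * (Rpower t 1 * Rpower t (- beta)))
        by (rewrite (Rpower_1 t Ht); ring).
      rewrite <- Rpower_plus. change (1 + - beta) with (1 - beta).
      rewrite Et, Hsm, Eh, (Rpower_Ropp d alpha). field.
      pose proof (Rpower_gt0 d alpha). lra.
  (* Here z already lies at height more than t, and the hypothesis applies at z itself. *)
  - assert (nrm (Res z) <= b) as Hb by (apply res_le; fold d; lra).
    assert (0 <= b); [|lra]. eapply Rle_trans; [apply (nrm_ge0 (Res z))|eassumption].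
Qed.

Lemma wres_le k n N j : (1 <= n)%nat ->
  nrm (wres Res k (1 + / (2 * INR n)) N j)
  <= M * Rpower (2 * INR n) beta * Rpower (dist1 (1 + / (2 * INR n)) N j) (INR k - alpha).
Proof.
  intros Hn. assert (1 <= INR n) by (change 1 with (INR 1); apply le_INR; lia).
  assert (0 < / (2 * INR n) <= / 2) as Hh.
  { split; [apply Rinv_0_lt_compat; lra|apply Rinv_le_contravar; lra]. }
  set (h := / (2 * INR n)) in *. set (r := 1 + h).
  pose proof (dist1_lower_r r N j ltac:(unfold r; lra)) as Hd.
  assert (0 < dist1 r N j) as Hd0 by (unfold r in *; lra).
  assert (nrm (Res (pnt r N j)) <= M * Rpower (dist1 r N j) (- alpha) * Rpower h (- beta)) as HR.
  { apply res_le; rewrite ?Cmod_pnt; unfold r, dist1 in *; lra. }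
  replace (Rpower h (- beta)) with (Rpower (2 * INR n) beta) in HR.
  2:{ unfold h, Rpower. rewrite ln_Rinv by lra. f_equal. ring. }
  unfold wres. rewrite <- emb_pow.
  eapply Rle_trans; [apply nrm_emb_mul_le; [apply Rle_refl|exact HR]|].
  rewrite Cmod_pow. replace (RtoC 1 - pnt r N j)%C with (- (pnt r N j - 1))%C by ring.
  rewrite Cmod_opp. fold (dist1 r N j). rewrite <- Rpower_pow by assumption.
  unfold Rminus. rewrite Rpower_plus. right. ring.
Qed.

(** The weight N/(2n) is the zeta of [abel_iter]. Multiplied by the step length of order 1/N it
    leaves 1/n, so the right side no longer contains N. *)
Lemma fdn_wres_le k : exists K, 1 <= K /\ forall n N j i,
  (1 <= n)%nat -> (i <= k)%nat -> 64 * INR n * INR (k + 1) <= INR N -> (j <= N)%nat ->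
  let d := dist1 (1 + / (2 * INR n)) N j in
  (INR N / (2 * INR n)) ^ i * nrm (fdn i (wres Res k (1 + / (2 * INR n)) N) j)
  <= K * (d ^ k * Rpower d (- s)) * (Rpower d (- s) / INR n) ^ i.
Proof.
  pose proof one_lt_s as Hs.
  destruct res_le_dist as [C [HC HRd]].
  destruct (symbol_wres T Res HRes k k) as [K1 [HK1 HS]].
  pose proof (Rpower_gt0 (5 / 2) s) as P1. pose proof (Rpower_gt0 2 s) as P2.
  set (C2 := C * Rpower 2 s).
  assert (0 < C2) as HC2 by (apply Rmult_lt_0_compat; lra).
  assert (1 <= Rpower 2 s) as P3.
  { rewrite <- (Rpower_O 2) by lra. apply Rle_Rpower; lra. }
  assert (C <= C2) as HCC by (unfold C2; nra).
  set (q := 1 + 4 * K1 * C2).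
  assert (0 < K1 * C2) as HKC by (apply Rmult_lt_0_compat; lra).
  assert (1 <= q) as Hq by (unfold q; lra).
  assert (0 < 2 ^ k) as P4 by (apply pow_lt; lra).
  assert (1 <= q ^ k) as P5 by (now apply pow_R1_Rle).
  assert (0 < K1 * 2 ^ k * C2 * q ^ k) as P6 by (repeat apply Rmult_lt_0_compat; lra).
  exists (1 + K1 * 2 ^ k * C2 * q ^ k). split; [lra|].
  intros n N j i Hn Hi HN Hj d.
  assert (1 <= INR n) as Hn1 by (change 1 with (INR 1); apply le_INR; lia).
  assert (1 <= INR (k + 1)) as Hk1 by (change 1 with (INR 1); apply le_INR; lia).
  assert (0 < / (2 * INR n) <= / 2) as Hh.
  { split; [apply Rinv_0_lt_compat; lra|apply Rinv_le_contravar; lra]. }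
  assert (64 <= INR N) as HN64 by nra.
  assert (0 < N)%nat as HN0 by (destruct N; [simpl in HN64; lra|lia]).
  set (h := / (2 * INR n)) in *. set (r := 1 + h) in *.
  assert (h <= d) as Hdh by (pose proof (dist1_lower_r r N j ltac:(unfold r; lra)); unfold r in *; fold d in H; lra).
  assert (d <= 5 / 2) as Hd52.
  { unfold d, dist1. pose proof (Cmod_triangle (pnt r N j) (- (1))) as T2.
    rewrite Cmod_m1, Cmod_pnt in T2 by (unfold r; lra). unfold Cminus. unfold r in *. lra. }
  (* The factor 64 in the lower bound on N serves here: over k consecutive sample points the
     distance to 1 changes by at most d/2, so one size w works for all of them. *)
  assert (INR k * (16 / INR N) <= d / 2) as Hkd.
  { assert (INR k * (16 / INR N) <= h / 2); [|lra].
    rewrite plus_INR in HN. simpl (INR 1) in HN. pose proof (pos_INR k).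
    apply Rmult_le_reg_r with (INR N * (2 * INR n)); [apply Rmult_lt_0_compat; lra|].
    replace (INR k * (16 / INR N) * (INR N * (2 * INR n))) with (32 * INR n * INR k) by (field; lra).
    replace (h / 2 * (INR N * (2 * INR n))) with (INR N / 2) by (unfold h; field; lra).
    nra. }
  assert (forall t, (t <= k)%nat -> d / 2 <= dist1 r N (j + t) <= 2 * d) as Hshift.
  { intros t Ht. pose proof (dist1_shift r N j t ltac:(unfold r; lra) HN0) as G.
    assert (INR t * (16 / INR N) <= INR k * (16 / INR N)).
    { apply Rmult_le_compat_r; [apply Rlt_le, Rdiv_lt_0_compat; lra|]. apply le_INR; lia. }
    fold d in G. apply Rabs_le_between in G. lra. }
  pose proof (Rpower_gt0 d (- s)) as P7.
  assert (1 <= C2 * Rpower d (- s)) as Hw1.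
  { apply Rle_trans with (Rpower (5 / 2) s * Rpower (5 / 2) (- s)).
    - rewrite <- Rpower_plus, Rplus_opp_r, Rpower_O; lra.
    - apply Rmult_le_compat; try lra; [apply Rlt_le, Rpower_gt0|]. apply Rpower_antitone; lra. }
  (* Since s > 1, d^(1-s) decreases in d, and d <= 5/2. *)
  assert (1 <= C2 * Rpower d (- s) * (2 * d)) as Hw2.
  { apply Rle_trans with (Rpower (5 / 2) s * Rpower (5 / 2) (1 - s)).
    - rewrite <- Rpower_plus. replace (s + (1 - s)) with 1 by ring. rewrite Rpower_1; lra.
    - apply Rle_trans with (C2 * Rpower d (1 - s)).
      + apply Rmult_le_compat; try lra; [apply Rlt_le, Rpower_gt0|]. apply Rpower_antitone; lra.
      + unfold Rminus. rewrite Rpower_plus, Rpower_1 by lra. nra. }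
  specialize (HS r N j (C2 * Rpower d (- s)) (2 * d) ltac:(unfold r; lra) Hw1 Hw2).
  assert (nrm (fdn i (wres Res k r N) j)
    <= K1 * (2 * d) ^ k * (C2 * Rpower d (- s)) *
       (K1 * (C2 * Rpower d (- s)) * Cmod (cis (2 * PI / INR N) - 1)) ^ i) as HF.
  { replace j with (j + 0)%nat at 1 by lia. rewrite <- fdn_shift. apply HS; [| |lia].
    - intros t Ht. eapply Rle_trans; [apply HRd; rewrite Cmod_pnt; unfold r; lra|].
      fold (dist1 r N (j + t)). unfold C2. rewrite Rmult_assoc. apply Rmult_le_compat_l; [lra|].
      apply Rle_trans with (Rpower (d / 2) (- s)).
      + apply Rpower_antitone; [lra|]. split; [lra|now apply Hshift].
      + unfold Rdiv. rewrite <- Rpower_mult_distr by lra. right. rewrite Rmult_comm. f_equal.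
        unfold Rpower. rewrite ln_Rinv by lra. f_equal. ring.
    - intros t Ht. replace (1 - pnt r N (j + t))%C with (- (pnt r N (j + t) - 1))%C by ring.
      rewrite Cmod_opp. now apply Hshift. }
  assert (Cmod (cis (2 * PI / INR N) - 1) <= 8 / INR N) as Hdelta.
  { eapply Rle_trans; [apply Cmod_cis_sub_1_le|]. pose proof PI_4. pose proof PI_RGT_0.
    assert (0 < / INR N) by (apply Rinv_0_lt_compat; lra).
    unfold Rdiv. rewrite Rabs_right by nra. nra. }
  pose proof (Cmod_ge_0 (cis (2 * PI / INR N) - 1)) as Hdelta0.
  set (delta := Cmod (cis (2 * PI / INR N) - 1)) in *.
  set (u := Rpower d (- s)) in *.
  assert (0 < INR N / (2 * INR n)) as Hz by (apply Rdiv_lt_0_compat; lra).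
  apply Rle_trans with ((INR N / (2 * INR n)) ^ i * (K1 * (2 * d) ^ k * (C2 * u) * (K1 * (C2 * u) * delta) ^ i)).
  { apply Rmult_le_compat_l; [apply pow_le; lra|assumption]. }
  replace ((INR N / (2 * INR n)) ^ i * (K1 * (2 * d) ^ k * (C2 * u) * (K1 * (C2 * u) * delta) ^ i))
    with ((K1 * 2 ^ k * C2) * (d ^ k * u) * ((INR N / (2 * INR n)) * (K1 * (C2 * u) * delta)) ^ i)
    by (rewrite !Rpow_mult_distr; ring).
  assert (0 < d ^ k) by (apply pow_lt; lra).
  assert (0 < u / INR n) by (apply Rdiv_lt_0_compat; lra).
  assert (((INR N / (2 * INR n)) * (K1 * (C2 * u) * delta)) ^ i <= q ^ k * (u / INR n) ^ i) as HP.
  { apply Rle_trans with ((q * (u / INR n)) ^ i).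
    - apply pow_incr. split.
      + apply Rmult_le_pos; [lra|]. apply Rmult_le_pos; [|lra].
        apply Rmult_le_pos; [lra|]. apply Rmult_le_pos; lra.
      + apply Rle_trans with ((INR N / (2 * INR n)) * (K1 * (C2 * u) * (8 / INR N))).
        * apply Rmult_le_compat_l; [lra|]. apply Rmult_le_compat_l; [|assumption].
          apply Rmult_le_pos; [lra|]. apply Rmult_le_pos; lra.
        * replace ((INR N / (2 * INR n)) * (K1 * (C2 * u) * (8 / INR N)))
            with (4 * K1 * C2 * (u / INR n)) by (field; lra).
          apply Rmult_le_compat_r; [lra|]. unfold q. lra.
    - rewrite Rpow_mult_distr. apply Rmult_le_compat_r; [apply pow_le; lra|].
      now apply Rle_pow. }
  assert (0 < d ^ k * u) by (apply Rmult_lt_0_compat; lra).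
  assert (0 <= (u / INR n) ^ i) by (apply pow_le; lra).
  apply Rle_trans with ((K1 * 2 ^ k * C2) * (d ^ k * u) * (q ^ k * (u / INR n) ^ i)).
  - apply Rmult_le_compat_l; [|assumption]. apply Rmult_le_pos; [|lra].
    repeat apply Rmult_le_pos; lra.
  - replace ((K1 * 2 ^ k * C2) * (d ^ k * u) * (q ^ k * (u / INR n) ^ i))
      with ((K1 * 2 ^ k * C2 * q ^ k) * ((d ^ k * u) * (u / INR n) ^ i)) by ring.
    rewrite (Rmult_assoc (1 + _) (d ^ k * u) _). apply Rmult_le_compat_r; [|lra]. apply Rmult_le_pos; lra.
Qed.


(** With the radius pulled out, lambda_j^(n+1) becomes a geometric sequence on the unit circle, the
    form required by summation by parts. *)
Lemma cauchy_sum_eq k r N n : cauchy_sum Res r N k n =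
  (emb (RtoC (r ^ (n + 1))) *
   asum (fun j => emb (cis (2 * PI * INR (n + 1) / INR N) ^ j)%C * wres Res k r N j)%A N)%A.
Proof.
  unfold cauchy_sum. rewrite <- asum_mul. apply asum_ext. intros j _. unfold wres.
  rewrite pnt_pow, !emb_mul, (emb_pow (RtoC 1 - _)%C). ring.
Qed.

Lemma avg_le (k : nat) : alpha - 1 < INR k -> exists C, 0 < C /\ forall n, (1 <= n)%nat ->
  exists N0, forall N, (N0 <= N)%nat ->
  nrm (avg Res (1 + / (2 * INR n)) N k n)
  <= C * Rpower (Rpower (INR n) (- / s)) (INR k + 1 - s).
Proof.
  intros hk. pose proof one_lt_s as Hs. pose proof s_mul as Hsm.
  (* After k summations the summand is n^-k d^-p, where p - 1 = (s - 1)(k + 1) > 0. *)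
  set (p := s * (INR k + 1) - INR k).
  pose proof (pos_INR k) as Hk0.
  assert (1 < p) as Hp by (unfold p; nra).
  destruct (rsum_power_near (INR k - alpha) ltac:(lra)) as [C1 [HC1 Hnear]].
  destruct (rsum_power_far p Hp) as [C2 [HC2 Hfar]].
  destruct (fdn_wres_le k) as [K [HK HF]].
  pose proof (Rpower_gt0 16 s) as P16. pose proof (Rpower_gt0 2 beta) as P2b.
  assert (1 <= Rpower 16 s) as P16'.
  { rewrite <- (Rpower_O 16) by lra. apply Rle_Rpower; lra. }
  assert (0 < 3 ^ k) as P3 by (apply pow_lt; lra).
  (* [C3] collects the boundary terms: with zeta = N/(2n) and the [B] below, 2 k zeta B is exactly
     C3 N x^k. [C4] covers each end arc, K C2 the remaining sum, and the outer 3 bounds r^(n+1). *)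
  set (C3 := INR k * (K * 3 ^ k * Rpower 16 s * Rpower 16 s ^ k)).
  assert (0 <= C3) as HC3.
  { unfold C3. apply Rmult_le_pos; [assumption|].
    repeat apply Rmult_le_pos; try lra. apply pow_le; lra. }
  set (C4 := M * Rpower 2 beta * C1).
  assert (0 < C4) as HC4 by (repeat apply Rmult_lt_0_compat; lra).
  assert (0 < K * C2) as HKC2 by (apply Rmult_lt_0_compat; lra).
  exists (3 * (C4 + (C3 + K * C2) + C4)). split; [lra|].
  intros n Hn.
  assert (1 <= INR n) as Hn1 by (change 1 with (INR 1); apply le_INR; lia).
  set (x := Rpower (INR n) (- / s)).
  assert (0 < x) as Hx by apply Rpower_gt0.
  assert (Rpower x (- s) = INR n) as Hxn.
  { unfold x. rewrite Rpower_mult. replace (- / s * - s) with 1 by (field; lra). apply Rpower_1; lra. }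
  assert (0 < / s) as His by (apply Rinv_0_lt_compat; lra).
  assert (x <= 1) as Hx1.
  { rewrite <- (Rpower_O (INR n)) by lra. apply Rle_Rpower; lra. }
  assert (/ INR n = Rpower x s) as Hxs.
  { rewrite <- Hxn, Rpower_Ropp, Rinv_inv. reflexivity. }
  assert (forall a b, a <= b -> Rpower x b <= Rpower x a) as Hxanti.
  { intros a b Hab. replace x with (/ / x) by (apply Rinv_inv).
    assert (1 <= / x) by (rewrite <- Rinv_1; apply Rinv_le_contravar; lra).
    assert (forall e, Rpower (/ / x) e = Rpower (/ x) (- e)) as E.
    { intros e. unfold Rpower. rewrite (ln_Rinv (/ x)) by lra. f_equal. ring. }
    rewrite !E. apply Rle_Rpower; lra. }
  assert (/ INR n <= x) as Hnx.
  { rewrite Hxs. rewrite <- (Rpower_1 x) at 2 by assumption. apply Hxanti. lra. }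
  (* The summands serve, in order, [fdn_wres_le], the inequalities 1/N <= 1/(2n) and n + 1 <= N/2,
     and a cut index large enough that taking its integer part loses at most a factor 2. *)
  destruct (INR_unbounded (64 * INR n * INR (k + 1) + 64 * INR n + 16 / x)) as [N0 HN0].
  exists N0. intros N HN.
  assert (0 < 16 / x) as H16 by (apply Rdiv_lt_0_compat; lra).
  pose proof (pos_INR (k + 1)) as Hk1.
  assert (0 <= 64 * INR n * INR (k + 1)) by (repeat apply Rmult_le_pos; lra).
  assert (64 * INR n * INR (k + 1) <= INR N /\ 64 * INR n <= INR N /\ 16 / x <= INR N) as [HNk [HNn HNx]].
  { apply le_INR in HN. lra. }
  assert (16 <= INR N * x) as HNx'.
  { apply Rle_trans with (16 / x * x); [right; field; lra|]. apply Rmult_le_compat_r; lra. }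
  (* The cut at J, about N x / 4, makes the distance to 1 at most x/2 + 8J/N <= 3x on the two end
     arcs and at least x/16 between them. *)
  destruct (nfloor_ex (INR N * x / 4)) as [J [HJ1 HJ2]]; [lra|].
  assert (1 <= J)%nat as HJ by (apply INR_le; simpl; lra).
  assert (4 * J <= N)%nat as HJN.
  { apply INR_le. rewrite mult_INR. simpl (INR 4). nra. }
  set (L := (N - J - J)%nat). assert (N = J + L + J)%nat as HNJ by (unfold L; lia).
  assert (0 < / (2 * INR n) <= / 2) as Hh.
  { split; [apply Rinv_0_lt_compat; lra|apply Rinv_le_contravar; lra]. }
  assert (/ (2 * INR n) <= x / 2) as Hhx.
  { rewrite Rinv_mult. lra. }
  assert (/ INR N <= / (2 * INR n)) as HNh by (apply Rinv_le_contravar; lra).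
  pose proof (pow_near_1_le_3 n Hn) as Hr3.
  pose proof (fun j => wres_le k n N j Hn) as Hw.
  specialize (HF n N).
  set (h := / (2 * INR n)) in *. set (r := 1 + h) in *.
  assert (1 <= r) as Hr1 by (unfold r; lra).
  assert (r - 1 = h) as Hrh by (unfold r; ring).
  set (Y := Rpower x (INR k + 1 - s)).
  assert (0 < Y) as HY by apply Rpower_gt0.
  set (F := wres Res k r N).
  set (z := cis (2 * PI * INR (n + 1) / INR N)).
  assert (0 < N)%nat as HN0' by lia.
  assert (INR N > 0) as HNpos by (apply lt_0_INR; lia).
  (* Both ends at once: [d] lists 0, 1, ... or N - 1, N - 2, ..., and the minimum is j + 1 in either
     case. *)
  assert (forall d : nat -> nat, (forall j, (j < J)%nat -> (d j < N)%nat /\ Nat.min (d j + 1) (N - d j) = (j + 1)%nat) ->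
    rsum (fun j => nrm (F (d j))) J <= C4 * (INR N * Y)) as Hends.
  { intros d Hd.
    apply Rle_trans with (rsum (fun j => M * Rpower (2 * INR n) beta * Rpower (dist1 r N (d j)) (INR k - alpha)) J).
    - apply rsum_le. intros j _. apply Hw.
    - rewrite rsum_scal.
      apply Rle_trans with (M * Rpower (2 * INR n) beta * (C1 * (INR N * Rpower x (INR k - alpha + 1)))).
      + apply Rmult_le_compat_l; [apply Rmult_le_pos; [lra|apply Rlt_le, Rpower_gt0]|].
        apply (Hnear (fun j => dist1 r N (d j))); try assumption; [nra|].
        intros j Hj. destruct (Hd j Hj) as [D1 D2]. split.
        * pose proof (dist1_lower_S r N (d j) Hr1 D1 ltac:(lra)) as G. rewrite D2, plus_INR in G. exact G.
        * eapply Rle_trans; [apply dist1_upper; (assumption || lia)|].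
          assert (INR (Nat.min (d j) (N - d j)) <= INR N * x / 4).
          { apply Rle_trans with (INR J); [|assumption]. apply le_INR. lia. }
          assert (8 * INR (Nat.min (d j) (N - d j)) / INR N <= 2 * x).
          { apply Rmult_le_reg_r with (INR N); [assumption|].
            unfold Rdiv. rewrite Rmult_assoc, Rinv_l by lra. lra. }
          lra.
      + right. unfold C4. rewrite <- Rpower_mult_distr by lra. rewrite <- Hxn at 1. rewrite Rpower_mult.
        unfold Y. replace (INR k + 1 - s) with (- s * beta + (INR k - alpha + 1)).
        * rewrite (Rpower_plus (- s * beta)). ring.
        * rewrite <- Hsm. ring. }
  assert (nrm (asum (fun j => emb (z ^ (J + j))%C * F (J + j)%nat)%A L) <= (C3 + K * C2) * (INR N * Y)) as Hmid.
  { assert (forall j, (J <= j)%nat -> (j <= J + L)%nat -> x / 16 <= dist1 r N j) as Hlow.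
    { intros j Hj1 Hj2. pose proof (dist1_lower r N j Hr1 ltac:(lia) ltac:(lia)) as G.
      eapply Rle_trans; [|exact G].
      apply Rmult_le_reg_r with (INR N); [assumption|].
      unfold Rdiv at 2. rewrite Rmult_assoc, Rinv_l, Rmult_1_r by lra.
      apply Rle_trans with (INR J); [lra|]. apply le_INR; lia. }
    assert (0 < INR N / (2 * INR n)) as Hzeta by (apply Rdiv_lt_0_compat; lra).
    set (B := K * ((3 * x) ^ k * (Rpower 16 s * INR n)) * Rpower 16 s ^ k).
    assert (forall j, j = J \/ j = (J + L)%nat -> forall i, (i < k)%nat ->
      (INR N / (2 * INR n)) ^ i * nrm (fdn i F j) <= B) as Hbd.
    { intros j Hj i Hi. eapply Rle_trans; [apply HF; (assumption || lia)|]. cbv zeta.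
      assert (x / 16 <= dist1 r N j <= 3 * x) as Hd.
      { split; [apply Hlow; lia|].
        eapply Rle_trans; [apply dist1_upper; (assumption || lia)|].
        replace (Nat.min j (N - j)) with J by lia.
        assert (8 * INR J / INR N <= 2 * x); [|lra].
        apply Rmult_le_reg_r with (INR N); [assumption|].
        unfold Rdiv. rewrite Rmult_assoc, Rinv_l by lra. lra. }
      set (d := dist1 r N j) in *. pose proof (Rpower_gt0 d (- s)) as Pu.
      assert (Rpower d (- s) <= Rpower 16 s * INR n) as Hu.
      { apply Rle_trans with (Rpower (x / 16) (- s)); [apply Rpower_antitone; lra|].
        unfold Rdiv. rewrite <- Rpower_mult_distr, Hxn by lra. right. rewrite Rmult_comm. f_equal.
        unfold Rpower. rewrite ln_Rinv by lra. f_equal. ring. }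
      assert (0 <= d ^ k) by (apply pow_le; lra).
      unfold B. apply Rmult_le_compat.
      - apply Rmult_le_pos; [lra|]. apply Rmult_le_pos; lra.
      - apply pow_le, Rlt_le, Rdiv_lt_0_compat; lra.
      - apply Rmult_le_compat_l; [lra|]. apply Rmult_le_compat; try lra. apply pow_incr. lra.
      - apply Rle_trans with (Rpower 16 s ^ i); [|apply Rle_pow; [assumption|lia]].
        apply pow_incr. split; [apply Rlt_le, Rdiv_lt_0_compat; lra|].
        apply Rmult_le_reg_r with (INR n); [lra|].
        unfold Rdiv. rewrite Rmult_assoc, Rinv_l, Rmult_1_r by lra. assumption. }
    eapply Rle_trans.
    { apply (abel_iter z J L (INR N / (2 * INR n))) with (m := k) (B := B)
        (Q := K * / INR n ^ k * (C2 * (INR N * Rpower x (1 - p)))).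
      - apply Cmod_cis.
      - assumption.
      - assert (2 * (n + 1) <= N)%nat as Hn2.
        { apply INR_le. rewrite mult_INR, plus_INR. simpl (INR 2). simpl (INR 1). lra. }
        pose proof (cis_root_far N (n + 1) HN0' ltac:(lia)) as G. fold z in G.
        replace (Nat.min (n + 1) (N - (n + 1))) with (n + 1)%nat in G by lia.
        apply Rle_trans with (INR N / (2 * INR n) * (2 * INR (n + 1) / INR N)).
        + rewrite plus_INR. simpl (INR 1).
          replace (INR N / (2 * INR n) * (2 * (INR n + 1) / INR N)) with (1 + / INR n) by (field; lra).
          assert (0 < / INR n) by (apply Rinv_0_lt_compat; lra). lra.
        + apply Rmult_le_compat_l; [lra|assumption].
      - apply Hbd. now left.
      - apply Hbd. now right.
      - apply Rle_trans with (rsum (fun i => K * / INR n ^ k * Rpower (dist1 r N (J + i)) (- p)) L).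
        + apply rsum_le. intros i Hi.
          eapply Rle_trans; [apply HF; (assumption || lia)|]. cbv zeta.
          assert (0 < dist1 r N (J + i)) as Hd by (pose proof (Hlow (J + i)%nat ltac:(lia) ltac:(lia)); lra).
          set (d := dist1 r N (J + i)) in *.
          replace (- p) with (INR k + - s + - s * INR k) by (unfold p; ring).
          rewrite !Rpower_plus, <- (Rpower_mult d (- s)), !Rpower_pow by (try apply Rpower_gt0; assumption).
          unfold Rdiv. rewrite Rpow_mult_distr, pow_inv. right. ring.
        + rewrite rsum_scal. apply Rmult_le_compat_l.
          * apply Rmult_le_pos; [lra|]. apply Rlt_le, Rinv_0_lt_compat, pow_lt. lra.
          * apply (Hfar (dist1 r N)); try assumption; [lra|].
            intros j Hj. apply dist1_lower_S; [assumption|lia|lra]. }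
    rewrite Rmult_plus_distr_r. apply Rplus_le_compat.
    - apply Rle_trans with (C3 * (INR N * x ^ k)).
      + right. unfold C3, B. rewrite Rpow_mult_distr. field. lra.
      (* As x <= 1 and s > 1, the boundary order x^k is at most x^(k+1-s). *)
      + apply Rmult_le_compat_l; [assumption|]. apply Rmult_le_compat_l; [lra|].
        rewrite <- Rpower_pow by assumption. apply Hxanti. lra.
    (* With 1/n = x^s, the order n^-k x^(1-p) is x^(sk+1-p) = x^(k+1-s). *)
    - right. rewrite <- pow_inv, Hxs, <- Rpower_pow, Rpower_mult by apply Rpower_gt0.
      unfold Y. replace (INR k + 1 - s) with (s * INR k + (1 - p)) by (unfold p; ring).
      rewrite (Rpower_plus (s * INR k)). ring. }
  unfold avg. rewrite cauchy_sum_eq. fold F. fold z.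
  apply Rle_trans with (/ INR N * (3 * (C4 * (INR N * Y) + (C3 + K * C2) * (INR N * Y) + C4 * (INR N * Y)))).
  2:{ right. fold Y. field. lra. }
  apply nrm_emb_mul_le.
  { rewrite Cmod_R, Rabs_right; [lra|]. apply Rle_ge, Rlt_le, Rinv_0_lt_compat; lra. }
  apply nrm_emb_mul_le.
  { rewrite Cmod_R, Rabs_right; [assumption|]. apply Rle_ge, pow_le. lra. }
  assert (forall i y, nrm (emb (z ^ i)%C * y) <= nrm y) as U.
  { intros i y. eapply Rle_trans; [apply nrm_emb_mul|].
    unfold z. rewrite Cmod_pow, Cmod_cis, pow1. lra. }
  rewrite HNJ at 1. rewrite !asum_split.
  eapply Rle_trans; [apply nrm_add|]. apply Rplus_le_compat.
  - eapply Rle_trans; [apply nrm_add|]. apply Rplus_le_compat; [|exact Hmid].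
    eapply Rle_trans; [apply nrm_asum|].
    eapply Rle_trans; [|apply (Hends (fun j => j)); intros; lia].
    apply rsum_le. intros; apply U.
  - eapply Rle_trans; [apply nrm_asum|].
    eapply Rle_trans; [apply rsum_le with (g := fun j => nrm (F (J + L + j)%nat)); intros; apply U|].
    rewrite <- rsum_rev. apply (Hends (fun j => (J + L + (J - 1 - j))%nat)). intros; lia.
Qed.

Lemma nrm_pow_one_sub_le (k : nat) : alpha - 1 < INR k -> exists C, 0 < C /\ forall n, (1 <= n)%nat ->
  nrm (T ^ n * (1 - T) ^ k)%A <= C * Rpower (INR n) ((alpha + (beta - 1) * (INR k + 1)) / alpha).
Proof.
  intros hk. pose proof one_lt_s as Hs. destruct (avg_le k hk) as [C [HC H]].
  exists (2 * C). split; [lra|]. intros n Hn. destruct (H n Hn) as [N0 HN].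
  assert (1 <= INR n) as Hn1 by (change 1 with (INR 1); apply le_INR; lia).
  rewrite Rmult_assoc.
  apply (nrm_pow_le_avg T Res HRes (1 + / (2 * INR n))) with (N0 := N0).
  - assert (0 < / (2 * INR n)); [apply Rinv_0_lt_compat|]; lra.
  - intros N HN'. eapply Rle_trans; [now apply HN|]. right. f_equal.
    rewrite Rpower_mult. f_equal. unfold s. field. lra.
Qed.

End Estimate.

(** * Bounded operators *)

Section OperatorNorm.
Context {X : NormedModule C_AbsRing}.
Implicit Types A B : X -> X.

Lemma opnorm_ub A x : is_linear A -> norm x <= 1 -> norm (A x) <= opnorm A.
Proof.
  intros [_ _ [M [HM HA]]] Hx. unfold opnorm.
  destruct (Lub_Rbar_correct (fun r => exists x : X, norm x <= 1 /\ r = norm (A x))) as [Hub Hlub].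
  specialize (Hub (norm (A x)) (ex_intro _ x (conj Hx eq_refl))).
  assert (Rbar_le (Lub_Rbar (fun r => exists x : X, norm x <= 1 /\ r = norm (A x))) M) as HM'.
  { apply Hlub. intros r [y [Hy ->]]. simpl. eapply Rle_trans; [apply HA|]. nra. }
  destruct (Lub_Rbar _); simpl in *; [assumption|contradiction..].
Qed.

Lemma opnorm_le A b : 0 <= b -> (forall x, norm (A x) <= b * norm x) -> opnorm A <= b.
Proof.
  intros Hb HA. unfold opnorm.
  destruct (Lub_Rbar_correct (fun r => exists x : X, norm x <= 1 /\ r = norm (A x))) as [_ Hlub].
  assert (Rbar_le (Lub_Rbar (fun r => exists x : X, norm x <= 1 /\ r = norm (A x))) b) as H.
  { apply Hlub. intros r [y [Hy ->]]. simpl. eapply Rle_trans; [apply HA|].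
    rewrite <- (Rmult_1_r b) at 2. now apply Rmult_le_compat_l. }
  (* In the [m_infty] case [real] returns 0 and the goal is [0 <= b]. *)
  destruct (Lub_Rbar _); simpl in *; [assumption|contradiction|assumption].
Qed.

Lemma opnorm_ge0 A : is_linear A -> 0 <= opnorm A.
Proof.
  intros HA. pose proof (opnorm_ub A zero HA) as H.
  rewrite (linear_zero A HA), !norm_zero in H. apply H. lra.
Qed.

Lemma norm_apply_le A x : is_linear A -> norm (A x) <= opnorm A * norm x.
Proof.
  intros HA. destruct (Rle_lt_or_eq_dec 0 (norm x) (norm_ge_0 x)) as [Hx|Hx].
  - set (y := scal (RtoC (/ norm x) : C_AbsRing) x).
    assert (norm y <= 1) as Hy.
    { eapply Rle_trans; [exact (norm_scal (RtoC (/ norm x) : C_AbsRing) x)|].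
      change (abs (RtoC (/ norm x) : C_AbsRing)) with (Cmod (RtoC (/ norm x))).
      rewrite Cmod_R, Rabs_right by (apply Rle_ge, Rlt_le, Rinv_0_lt_compat, Hx).
      rewrite Rinv_l; lra. }
    assert (x = scal (RtoC (norm x) : C_AbsRing) y) as E.
    { unfold y. rewrite scal_assoc.
      change (mult (RtoC (norm x) : C_AbsRing) (RtoC (/ norm x) : C_AbsRing))
        with (RtoC (norm x) * RtoC (/ norm x))%C.
      rewrite <- RtoC_mult, Rinv_r by lra. symmetry. exact (@scal_one C_AbsRing X x). }
    rewrite E at 1. rewrite (linear_scal A HA).
    eapply Rle_trans; [exact (norm_scal (RtoC (norm x) : C_AbsRing) (A y))|].
    change (abs (RtoC (norm x) : C_AbsRing)) with (Cmod (RtoC (norm x))).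
    rewrite Cmod_R, Rabs_right, Rmult_comm by (apply Rle_ge, norm_ge_0).
    apply Rmult_le_compat_r; [lra|]. now apply opnorm_ub.
  - rewrite <- Hx, Rmult_0_r. rewrite (norm_eq_zero x) by easy.
    rewrite (linear_zero A HA), norm_zero. lra.
Qed.

Lemma is_linear_add A B : is_linear A -> is_linear B -> is_linear (fun x => plus (A x) (B x)).
Proof.
  intros HA HB.
  exact (is_linear_comp (fun x => (A x, B x)) (fun t => plus (fst t) (snd t))
    (is_linear_prod A B HA HB) is_linear_plus).
Qed.

Lemma is_linear_neg A : is_linear A -> is_linear (fun x => opp (A x)).
Proof. intros HA. exact (is_linear_comp A opp HA is_linear_opp). Qed.

Lemma is_linear_scalar z : is_linear (@op_scalar X z).
Proof. apply is_linear_scal_r. exact Cmult_comm. Qed.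

End OperatorNorm.

(* The bicommutant of [T] is commutative because [T] lies in its own commutant, and it contains
   the resolvents of [T]. *)
Section Bicommutant.
Context {X : NormedModule C_AbsRing} (T : X -> X) (hT : is_linear T).

Definition in_bicomm (A : X -> X) : Prop :=
  is_linear A /\ forall B : X -> X, is_linear B -> (forall x, B (T x) = T (B x)) ->
  forall x, A (B x) = B (A x).

Definition bicomm : Type := {A : X -> X | in_bicomm A}.

(** The ring structure is over Leibniz equality, so pointwise equality of maps must also identify
    the membership proofs. *)
Lemma bicomm_eq (a b : bicomm) : (forall x, proj1_sig a x = proj1_sig b x) -> a = b.
Proof.
  destruct a as [A HA], b as [B HB]. simpl. intros H.
  apply functional_extensionality in H. subst B. f_equal. apply proof_irrelevance.
Qed.

Lemma in_bicomm_T : in_bicomm T.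
Proof. split; [assumption|]. intros B _ H x. now rewrite H. Qed.

Lemma in_bicomm_zero : in_bicomm (fun _ => zero).
Proof. split; [apply is_linear_zero|]. intros B HB _ x. now rewrite (linear_zero B HB). Qed.

Lemma in_bicomm_scalar z : in_bicomm (op_scalar z).
Proof.
  split; [apply is_linear_scalar|]. intros B HB _ x. unfold op_scalar. now rewrite (linear_scal B HB).
Qed.

Lemma in_bicomm_id : in_bicomm op_id.
Proof. split; [apply is_linear_id|reflexivity]. Qed.

Lemma in_bicomm_add A B : in_bicomm A -> in_bicomm B -> in_bicomm (fun x => plus (A x) (B x)).
Proof.
  intros [LA HA] [LB HB]. split; [now apply is_linear_add|]. intros C LC HC x.
  now rewrite HA, HB, (linear_plus C LC).
Qed.

Lemma in_bicomm_neg A : in_bicomm A -> in_bicomm (fun x => opp (A x)).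
Proof.
  intros [LA HA]. split; [now apply is_linear_neg|]. intros C LC HC x.
  now rewrite HA, (linear_opp C _ LC).
Qed.

Lemma in_bicomm_comp A B : in_bicomm A -> in_bicomm B -> in_bicomm (op_comp A B).
Proof.
  intros [LA HA] [LB HB]. split; [exact (is_linear_comp B A LB LA)|]. intros C LC HC x.
  unfold op_comp. now rewrite HB, HA.
Qed.

Definition bzero : bicomm := exist _ _ in_bicomm_zero.
Definition bone : bicomm := exist _ _ in_bicomm_id.
Definition bscalar z : bicomm := exist _ _ (in_bicomm_scalar z).
Definition badd (a b : bicomm) : bicomm := exist _ _ (in_bicomm_add _ _ (proj2_sig a) (proj2_sig b)).
Definition bopp (a : bicomm) : bicomm := exist _ _ (in_bicomm_neg _ (proj2_sig a)).
Definition bmul (a b : bicomm) : bicomm := exist _ _ (in_bicomm_comp _ _ (proj2_sig a) (proj2_sig b)).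
Definition bT : bicomm := exist _ _ in_bicomm_T.
Definition bnorm (a : bicomm) : R := opnorm (proj1_sig a).

Lemma bmul_comm a b : bmul a b = bmul b a.
Proof.
  apply bicomm_eq. intros x. destruct a as [A [LA HA]], b as [B [LB HB]]. simpl. unfold op_comp.
  apply HA; [assumption|]. intros y. now apply HB.
Qed.

Lemma bicomm_ring : ring_theory bzero bone badd bmul (fun a b => badd a (bopp b)) bopp eq.
Proof.
  split; intros; try reflexivity; try apply bmul_comm; apply bicomm_eq; intros t; simpl.
  - apply plus_zero_l.
  - apply plus_comm.
  - apply plus_assoc.
  - reflexivity.
  - reflexivity.
  - reflexivity.
  - exact (@plus_opp_r (NormedModule.AbelianGroup C_AbsRing X) _).
Qed.

Lemma bicomm_linear (a : bicomm) : is_linear (proj1_sig a).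
Proof. apply (proj2_sig a). Qed.

Lemma bnorm_add a b : bnorm (badd a b) <= bnorm a + bnorm b.
Proof.
  pose proof (bicomm_linear a) as La. pose proof (bicomm_linear b) as Lb.
  apply opnorm_le; [apply Rplus_le_le_0_compat; now apply opnorm_ge0|]. intros x. simpl.
  eapply Rle_trans; [apply norm_triangle|]. rewrite Rmult_plus_distr_r.
  apply Rplus_le_compat; now apply norm_apply_le.
Qed.

Lemma bnorm_mul a b : bnorm (bmul a b) <= bnorm a * bnorm b.
Proof.
  pose proof (bicomm_linear a) as La. pose proof (bicomm_linear b) as Lb.
  apply opnorm_le; [apply Rmult_le_pos; now apply opnorm_ge0|]. intros x. simpl. unfold op_comp.
  eapply Rle_trans; [now apply norm_apply_le|]. rewrite Rmult_assoc.
  apply Rmult_le_compat_l; [now apply opnorm_ge0|]. now apply norm_apply_le.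
Qed.

Lemma bnorm_scalar_mul z a : bnorm (bmul (bscalar z) a) <= Cmod z * bnorm a.
Proof.
  pose proof (bicomm_linear a) as La.
  apply opnorm_le; [apply Rmult_le_pos; [apply Cmod_ge_0|now apply opnorm_ge0]|]. intros x. simpl.
  eapply Rle_trans; [exact (norm_scal (z : C_AbsRing) _)|]. rewrite Rmult_assoc.
  apply Rmult_le_compat_l; [apply Cmod_ge_0|]. now apply norm_apply_le.
Qed.

Lemma bnorm_one : bnorm bone <= 1.
Proof. apply opnorm_le; [lra|]. intros x. simpl. unfold op_id. lra. Qed.

Lemma bscalar_1 : bscalar 1 = bone.
Proof. apply bicomm_eq. intros x. exact (@scal_one C_AbsRing X x). Qed.

Lemma bscalar_add y z : bscalar (y + z) = badd (bscalar y) (bscalar z).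
Proof. apply bicomm_eq. intros x. exact (scal_distr_r (y : C_AbsRing) (z : C_AbsRing) x). Qed.

Lemma bscalar_mul y z : bscalar (y * z) = bmul (bscalar y) (bscalar z).
Proof. apply bicomm_eq. intros x. symmetry. exact (scal_assoc (y : C_AbsRing) (z : C_AbsRing) x). Qed.

Definition bicomm_alg : comm_normed_alg :=
  Calg bicomm bzero bone badd bmul (fun a b => badd a (bopp b)) bopp bscalar bnorm
    bicomm_ring bscalar_1 bscalar_add bscalar_mul
    (fun a => opnorm_ge0 _ (bicomm_linear a)) bnorm_one bnorm_add bnorm_mul bnorm_scalar_mul.

(** An operator B commuting with T commutes with D = z - T, and S B = S B D S = S D B S = B S. *)
Lemma in_bicomm_inverse z S : is_op_inverse (op_sub (op_scalar z) T) S -> in_bicomm S.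
Proof.
  intros [LS [HR HL]]. split; [assumption|]. intros B LB HB x.
  unfold op_comp in *. set (D := op_sub (op_scalar z) T) in *.
  assert (forall y, B (D y) = D (B y)) as HD.
  { intros y. unfold D, op_sub, op_scalar. now rewrite (linear_minus B _ _ LB), HB, (linear_scal B LB). }
  rewrite <- (HR x) at 1. now rewrite HD, HL.
Qed.

(** On the spectrum [resolvent] is an arbitrary map that may lie outside the bicommutant; zero is
    the default there. *)
Definition bres (z : Complex.C) : bicomm :=
  match excluded_middle_informative (in_bicomm (resolvent z T)) with
  | left p => exist _ _ p
  | right _ => bzero
  end.

Lemma bres_spec z : ~ spectrum T z ->
  proj1_sig (bres z) = resolvent z T /\ bmul (badd (bscalar z) (bopp bT)) (bres z) = bone.
Proof.
  intros Hz. apply NNPP in Hz.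
  pose proof (epsilon_spec (inhabits (fun _ : X => zero)) _ Hz) as HS. fold (resolvent z T) in HS.
  unfold bres. destruct (excluded_middle_informative _) as [p|p];
    [|destruct p; now apply in_bicomm_inverse with z].
  split; [reflexivity|]. apply bicomm_eq. apply HS.
Qed.

Lemma apow_bT n : proj1_sig (apow (A := bicomm_alg) bT n) = op_pow T n.
Proof.
  unfold op_pow. induction n as [|n IH]; [reflexivity|].
  change (op_comp T (proj1_sig (apow (A := bicomm_alg) bT n)) = op_comp T (Nat.iter n (op_comp T) op_id)).
  now rewrite IH.
Qed.

Lemma apow_one_sub_bT k :
  proj1_sig (apow (A := bicomm_alg) (badd bone (bopp bT)) k) = op_pow (op_sub op_id T) k.
Proof.
  unfold op_pow. induction k as [|k IH]; [reflexivity|].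
  change (op_comp (op_sub op_id T) (proj1_sig (apow (A := bicomm_alg) (badd bone (bopp bT)) k))
    = op_comp (op_sub op_id T) (Nat.iter k (op_comp (op_sub op_id T)) op_id)).
  now rewrite IH.
Qed.

End Bicommutant.

Theorem theorem4p4 (alpha beta : R)
  (halpha : 0 < alpha) (hbeta0 : 0 <= beta) (hbeta1 : beta < 1)
  (hab : 1 < alpha + beta)
  (X : CompleteNormedModule C_AbsRing) (T : X -> X)
  (hT : is_linear T) (hRK : is_RK alpha beta T)
  (k : nat) (hk : alpha - 1 < INR k) :
  is_bigO
    (fun n => opnorm (op_comp (op_pow T n) (op_pow (op_sub op_id T) k)))
    (fun n => Rpower (INR n) ((alpha + (beta - 1) * (INR k + 1)) / alpha)).
Proof.
  destruct hRK as [Hspec [M [HM HRes]]].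
  (* Inverses are needed on the whole exterior of the disk, since Rickart's argument may run at any
     radius up to [nrm T + 1]; the norm bound is used only in the annulus. *)
  assert (forall z, 1 < Cmod z -> ~ spectrum T z) as Hz.
  { intros z Hz Hs. specialize (Hspec z Hs). lra. }
  destruct (nrm_pow_one_sub_le (A := bicomm_alg T hT) (bT T hT) (bres T)) with
    (alpha := alpha) (beta := beta) (M := M) (k := k) as [C [HC H]]; try assumption.
  - intros z Hz1. now apply bres_spec, Hz.
  - intros z Hz1. change (bnorm T (bres T z) <= M / (Rpower (Cmod (z - 1)) alpha * Rpower (Cmod z - 1) beta)).
    unfold bnorm. rewrite (proj1 (bres_spec T hT z (Hz z (proj1 Hz1)))). now apply HRes.
  - exists C. split; [assumption|]. intros n Hn. specialize (H n Hn).
    rewrite <- (apow_bT T hT n), <- (apow_one_sub_bT T hT k). exact H.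
Qed.
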